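(* It is decidable, given a language $L$ accepted by a (one-way nondeterministic) reversal-bounded stack automaton, whether $L$ is dense. That is, there is an algorithm which, given a reversal-bounded stack automaton $M$ with input alphabet $\Sigma$ (together with a reversal bound for $M$), decides whether $\inf(L(M)) = \Sigma^*$.
   Context: For an alphabet $\Sigma$ and $L \subseteq \Sigma^*$, let $\inf(L) = \{y \in \Sigma^* \mid xyz \in L \text{ for some } x,z \in \Sigma^*\}$. $L$ is dense if $\inf(L) = \Sigma^*$. A (one-way nondeterministic) stack automaton is a nondeterministic pushdown automaton with a one-way read-only input, with $\lambda$-transitions allowed, which, in addition to pushing and popping at the top of its stack, may move its stack head into the interior of the stack, left or right (down or up) one cell at a time or staying in place, in read-only mode. Pushing and popping are possible only when the stack head is at the top of the stack. Transitions depend on the current state, the input letter read (or $\lambda$), and the stack symbol scanned by the stack head; the ends of the stack (bottom and top) are detectable. A word is accepted if some computation reads the entire word and ends in a final state. $L(M)$ denotes the set of accepted words. The automaton is reversal-bounded if there is an integer $l$ such that on every accepting computation the number of changes of direction of the stack read/write head is at most $l$, where movements of the head caused both by changing the stack (pushing moves the head up, popping moves it down) and by reading its interior are counted. Such an $l$ is a reversal bound. *)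

(* Defs.v *)
From HB Require Import structures.
From Stdlib Require List.
From mathcomp Require Import all_boot.

Set Implicit Arguments.
Unset Strict Implicit.
Unset Printing Implicit Defensive.

Inductive recfun : Type :=
| Zero
| Succ
| Proj of nat
| Comp of recfun & seq recfun
| Prec of recfun & recfun
| Mu of recfun.

(* Kleene's partial recursive functions, as a relation between an argument list
   and a value.  Arities are not part of the syntax: [Zero] is the constant 0 of
   any arity, and other ill-formed applications have no value.  In
   [Prec] and [Mu] the recursion/search variable is the first argument. *)
Inductive rec_eval : recfun -> seq nat -> nat -> Prop :=
| eval_zero xs : rec_eval Zero xs 0
| eval_succ x : rec_eval Succ [:: x] x.+1
| eval_proj i xs : i < size xs -> rec_eval (Proj i) xs (nth 0 xs i)
| eval_comp f gs xs ys v :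
    size ys = size gs ->
    (forall i, i < size gs -> rec_eval (nth Zero gs i) xs (nth 0 ys i)) ->
    rec_eval f ys v ->
    rec_eval (Comp f gs) xs v
| eval_prec0 f g xs v :
    rec_eval f xs v ->
    rec_eval (Prec f g) (0 :: xs) v
| eval_precS f g n xs u v :
    rec_eval (Prec f g) (n :: xs) u ->
    rec_eval g [:: n, u & xs] v ->
    rec_eval (Prec f g) (n.+1 :: xs) v
| eval_mu f xs n (us : nat -> nat) :
    (forall i, i < n -> rec_eval f (i :: xs) (us i).+1) ->
    rec_eval f (n :: xs) 0 ->
    rec_eval (Mu f) xs n.

Lemma rec_eval_fun f xs u v : rec_eval f xs u -> rec_eval f xs v -> u = v.
Proof.
move=> fu; elim: fu v => {f xs u}.
- by move=> xs v; inversion 1.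
- by move=> x v; inversion 1.
- by move=> i xs _ v; inversion 1.
- move=> f gs xs ys u sz _ IHg _ IHf v E; inversion E; subst.
  have eq_ys : ys = ys0.
    apply: (@eq_from_nth _ 0) => [|i]; first by rewrite sz.
    by rewrite sz => ltig; apply: IHg => //; auto.
  by apply: IHf; rewrite eq_ys.
- by move=> f g xs u _ IH v E; inversion E; subst; auto.
- move=> f g n xs r u _ IHr _ IHu v E; inversion E; subst.
  by apply: IHu; rewrite (IHr u0).
- move=> f xs n us _ IHlt _ IHn v E; inversion E as [| | | | | |? ? ? ws Hlt Hv].
  subst; case: (ltngtP n v) => // [ltnv|ltvn].
    by have := IHn _ (Hlt _ ltnv).
  by have := IHlt _ ltvn _ Hv.
Qed.

Definition language (A : Type) := seq A -> Prop.

Definition infixes (A : Type) (L : language A) : language A :=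
  fun y => exists x z, L (x ++ y ++ z).

Definition dense (A : Type) (L : language A) : Prop :=
  forall y, infixes L y.

Inductive action (m : nat) : Type :=
| Push of 'I_m
| Pop
| Down
| Up
| Stay.
Arguments Pop {m}.
Arguments Down {m}.
Arguments Up {m}.
Arguments Stay {m}.

(* [read = None] is a lambda-transition.  [scan = None] requires the head to be
   on the bottom marker, [scan = Some g] on a cell containing g; [at_top] is
   the required answer to "is the head at the top of the stack?". *)
Record rule (k n m : nat) : Type := Rule {
  source : 'I_n;
  read : option 'I_k;
  scan : option 'I_m;
  at_top : bool;
  target : 'I_n;
  act : action m
}.

(* Input alphabet 'I_k, state set 'I_n, stack alphabet 'I_m. *)
Record stack_automaton (k n m : nat) : Type := StackAutomaton {
  initial : 'I_n;
  finals : seq 'I_n;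
  rules : seq (rule k n m)
}.

(* The stack with its head, as a zipper: [below] lists the symbols from the
   scanned cell down to the bottom, [above] those above the head, nearest
   first.  The bottom marker lies under the last element of [below]; the head
   scans it iff [below] is empty, and is at the top iff [above] is empty. *)
Record store (m : nat) : Type := Store {
  below : seq 'I_m;
  above : seq 'I_m
}.

Definition do_action (m : nat) (a : action m) (s : store m) :
    option (store m) :=
  match a, below s, above s with
  | Push g, b,      [::]   => Some (Store (g :: b) [::])
  | Pop,    _ :: b, [::]   => Some (Store b [::])
  | Down,   g :: b, t      => Some (Store b (g :: t))
  | Up,     b,      g :: t => Some (Store (g :: b) t)
  | Stay,   _,      _      => Some s
  | _, _, _                => None
  end.

Definition step (k n m : nat) (r : rule k n m)
    (q : 'I_n) (s : store m) (q' : 'I_n) (s' : store m) : Prop :=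
  [/\ source r = q, target r = q', scan r = ohead (below s),
      at_top r = nilp (above s) & do_action (act r) s = Some s'].

(* [run M q s w tr q' s'] : from (q, s), M can reach (q', s') reading exactly
   the word w and performing the successive actions tr. *)
Inductive run (k n m : nat) (M : stack_automaton k n m) :
    'I_n -> store m -> seq 'I_k -> seq (action m) -> 'I_n -> store m -> Prop :=
| run_nil q s : run M q s [::] [::] q s
| run_cons r q s q1 s1 w tr q' s' :
    List.In r (rules M) ->
    step r q s q1 s1 ->
    run M q1 s1 w tr q' s' ->
    run M q s (seq_of_opt (read r) ++ w) (act r :: tr) q' s'.

Definition accepting_run (k n m : nat) (M : stack_automaton k n m)
    (w : seq 'I_k) (tr : seq (action m)) : Prop :=
  exists q s, q \in finals M /\ run M (initial M) (Store [::] [::]) w tr q s.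

Definition accepted (k n m : nat) (M : stack_automaton k n m) :
    language 'I_k :=
  fun w => exists tr, accepting_run M w tr.

(* Some true: upwards; Some false: downwards; None: the head does not move. *)
Definition direction (m : nat) (a : action m) : option bool :=
  match a with
  | Push _ | Up => Some true
  | Pop | Down => Some false
  | Stay => None
  end.

Definition reversals (m : nat) (tr : seq (action m)) : nat :=
  if pmap (@direction m) tr is d :: ds then count id (pairmap addb d ds)
  else 0.

Definition reversal_bound (k n m : nat) (M : stack_automaton k n m)
    (l : nat) : Prop :=
  forall w tr, accepting_run M w tr -> reversals tr <= l.

Definition action_code (m : nat) (a : action m) : nat :=
  match a with
  | Stay => 0
  | Down => 1
  | Up => 2
  | Pop => 3
  | Push g => g.+4
  end.

Definition option_code (k : nat) (o : option 'I_k) : nat :=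
  if o is Some i then i.+1 else 0.

Definition rule_code (k n m : nat) (r : rule k n m) : seq nat :=
  [:: source r : nat; option_code (read r); option_code (scan r);
      nat_of_bool (at_top r); target r : nat; action_code (act r)].

Definition automaton_code (k n m : nat) (M : stack_automaton k n m) :
    seq (seq nat) :=
  [:: [:: k; n; m; initial M : nat], map (@nat_of_ord n) (finals M)
    & map (@rule_code k n m) (rules M)].

(* [CodeSeq.code] is a computable bijection from seq nat to nat. *)
Definition automaton_number (k n m : nat) (M : stack_automaton k n m) : nat :=
  CodeSeq.code (map CodeSeq.code (automaton_code M)).

Lemma option_code_inj k : injective (@option_code k).
Proof. by move=> [i|] [j|] //= [/val_inj->]. Qed.

Lemma action_code_inj m : injective (@action_code m).
Proof. by move=> [g||||] [h||||] //= [/val_inj->]. Qed.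

Lemma rule_code_inj k n m : injective (@rule_code k n m).
Proof.
move=> [p a x t q c] [p' a' x' t' q' c'] [] /val_inj-> /option_code_inj->.
by move=> /option_code_inj-> + /val_inj-> /action_code_inj->; case: t t' => [] [].
Qed.

Lemma automaton_number_inj k n m : injective (@automaton_number k n m).
Proof.
move=> [i F R] [i' F' R'] /(can_inj CodeSeq.codeK).
move=> /(inj_map (can_inj CodeSeq.codeK)) [] /val_inj->.
by move=> /(inj_map val_inj)-> /(inj_map (@rule_code_inj k n m))->.
Qed.

(* Main.v *)
(** If y^(l+1) is an infix of an accepted word, then, as the head turns at most l
    times, some copy of y is read while the head never turns; call such words
    swept.  Hence M is dense iff all words are swept.  To compare two sweeps
    reading u1 v1 and u2 v2, cut each run at the height of the head between the
    two halves: the parts of the store below and above the cut interact only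
    through a bounded sequence of episodes, so a run can be glued from the lower
    part of one and the upper part of the other whenever these sequences agree.
    Thus the set of swept words has finitely many Nerode classes, and if some word
    is not swept then there is one of bounded length, whose power y^(l+1) is not
    an infix.  Gluing a run with itself at two different heights lowers it, which
    bounds the height, and then the length, of a shortest run witnessing that a
    given word is an infix.  Density is thereby decided by a bounded search. *)

Require Import Defs.
From Stdlib Require List.
From mathcomp Require Import all_boot boolp zify.

Set Implicit Arguments.
Unset Strict Implicit.
Unset Printing Implicit Defensive.

(** * Total recursive functions *)

(** All arguments come in one list, an environment in which variable [i] is [nth 0 e i]. As [recfun]
    has no arities, the code is constrained only on lists of length [a]. *)
Definition computable (a : nat) (f : seq nat -> nat) : Prop :=
  exists c, forall e, size e = a -> rec_eval c e (f e).

Lemma computable_ext a f g : f =1 g -> computable a f -> computable a g.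
Proof. by move=> fg [c cP]; exists c => e /cP; rewrite fg. Qed.

Lemma computable_var a i : i < a -> computable a (fun e => nth 0 e i).
Proof. by move=> lt_ia; exists (Proj i) => e sz; apply: eval_proj; rewrite sz. Qed.

Definition tuple_fun (fs : seq (seq nat -> nat)) (e : seq nat) : seq nat :=
  map (fun f => f e) fs.

Lemma computable_comp a fs F :
  computable (size fs) F -> List.Forall (computable a) fs ->
  computable a (fun e => F (tuple_fun fs e)).
Proof.
case=> c cP Cfs.
have [cs [sz csP]] : exists cs, size cs = size fs /\ forall e, size e = a ->
    forall i, i < size cs ->
    rec_eval (nth Zero cs i) e (nth 0 (tuple_fun fs e) i).
  elim: Cfs => [|f gs [d dP] _ [cs [sz csP]]]; first by exists [::].
  exists (d :: cs); split=> /= [|e sze [|i]]; first by rewrite sz.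
    by move=> _; apply: dP.
  by rewrite ltnS; apply: csP.
exists (Comp c cs) => e sze.
apply: (eval_comp (ys := tuple_fun fs e)); last by apply: cP; rewrite size_map.
  by rewrite size_map sz.
exact: csP.
Qed.

Lemma computable_const a k : computable a (fun=> k).
Proof.
elim: k => [|k [c cP]]; first by exists Zero => e _; constructor.
exists (Comp Succ [:: c]) => e sz.
apply: (eval_comp (ys := [:: k])) => //; last by constructor.
by case=> // _; apply: cP.
Qed.

(** Composition turns arguments into plain variables, so that each operation is treated only at its
    own fixed arity. *)
Lemma computable_comp1 a (F : nat -> nat) f :
  computable 1 (fun e => F (nth 0 e 0)) -> computable a f ->
  computable a (fun e => F (f e)).
Proof.
move=> CF Cf; have := @computable_comp a [:: f] _ CF; apply.
by do !constructor.
Qed.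

Lemma computable_comp2 a (F : nat -> nat -> nat) f g :
  computable 2 (fun e => F (nth 0 e 0) (nth 0 e 1)) ->
  computable a f -> computable a g -> computable a (fun e => F (f e) (g e)).
Proof.
move=> CF Cf Cg; have := @computable_comp a [:: f; g] _ CF; apply.
by do !constructor.
Qed.

Lemma computable_comp4 a (F : nat -> nat -> nat -> nat -> nat) f g h k :
  computable 4 (fun e => F (nth 0 e 0) (nth 0 e 1) (nth 0 e 2) (nth 0 e 3)) ->
  computable a f -> computable a g -> computable a h -> computable a k ->
  computable a (fun e => F (f e) (g e) (h e) (k e)).
Proof.
move=> CF Cf Cg Ch Ck; have := @computable_comp a [:: f; g; h; k] _ CF; apply.
by do !constructor.
Qed.

Lemma computable_succ a f : computable a f -> computable a (fun e => (f e).+1).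
Proof.
apply: computable_comp1; exists Succ => -[|x [|y e]] //= _; exact: eval_succ.
Qed.

Fixpoint primrec (u : nat) (step : nat -> nat -> nat) (n : nat) : nat :=
  if n is k.+1 then step k (primrec u step k) else u.

(** The recursion step sees the counter and the accumulator as variables 0 and 1, with the
    parameters behind them; hence the double [behead]. *)
Lemma computable_primrec a f g b :
  computable a f ->
  computable a.+2 (fun e => g (nth 0 e 0) (nth 0 e 1) (behead (behead e))) ->
  computable a b ->
  computable a (fun e => primrec (f e) (fun k u => g k u e) (b e)).
Proof.
move=> [cf cfP] [cg cgP] [cb cbP].
exists (Comp (Prec cf cg) (cb :: [seq Proj i | i <- iota 0 a])) => e sz.
apply: (eval_comp (ys := b e :: e)).
- by rewrite /= size_map size_iota sz.
- case=> [|i] /=; first by move=> _; apply: cbP.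
  rewrite size_map size_iota ltnS => lt_ia.
  rewrite (nth_map 0) ?size_iota // nth_iota // add0n.
  by apply: eval_proj; rewrite sz.
- elim: (b e) => [|k IH] /=; first by apply: eval_prec0; apply: cfP.
  by apply: (eval_precS IH); apply: (cgP [:: k, _ & e]) => /=; rewrite sz.
Qed.

Lemma computable_behead1 a i :
  i.+1 < a -> computable a (fun e => nth 0 (behead e) i).
Proof.
move=> lt_ia; apply: (@computable_ext a (fun e => nth 0 e i.+1)).
  by move=> e; rewrite nth_behead.
exact: computable_var.
Qed.

Lemma computable_behead2 a i :
  i.+2 < a -> computable a (fun e => nth 0 (behead (behead e)) i).
Proof.
move=> lt_ia; apply: (@computable_ext a (fun e => nth 0 e i.+2)).
  by move=> e; rewrite !nth_behead.
exact: computable_var.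
Qed.

Lemma computable_behead3 a i :
  i.+3 < a -> computable a (fun e => nth 0 (behead (behead (behead e))) i).
Proof.
move=> lt_ia; apply: (@computable_ext a (fun e => nth 0 e i.+3)).
  by move=> e; rewrite !nth_behead.
exact: computable_var.
Qed.

Lemma computable_pred a f : computable a f -> computable a (fun e => (f e).-1).
Proof.
apply: computable_comp1.
apply: (@computable_ext _ (fun e => primrec 0 (fun k _ => k) (nth 0 e 0))).
  by move=> e; case: (nth 0 e 0).
apply: (@computable_primrec 1 (fun=> 0) (fun k u e => k) (nth 0 ^~ 0)).
- exact: computable_const.
- exact: computable_var.
- exact: computable_var.
Qed.

Lemma computable_add a f g :
  computable a f -> computable a g -> computable a (fun e => f e + g e).
Proof.
apply: computable_comp2.
apply: (@computable_ext _ (fun e => primrec (nth 0 e 0) (fun k u => u.+1) (nth 0 e 1))).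
  by move=> e; elim: (nth 0 e 1) => [|k /= ->] /=; lia.
apply: (@computable_primrec 2 (nth 0 ^~ 0) (fun k u e => u.+1) (nth 0 ^~ 1)).
- exact: computable_var.
- by apply: computable_succ; apply: computable_var.
- exact: computable_var.
Qed.

Lemma computable_sub a f g :
  computable a f -> computable a g -> computable a (fun e => f e - g e).
Proof.
apply: computable_comp2.
apply: (@computable_ext _ (fun e => primrec (nth 0 e 0) (fun k u => u.-1) (nth 0 e 1))).
  by move=> e; elim: (nth 0 e 1) => [|k /= ->] /=; lia.
apply: (@computable_primrec 2 (nth 0 ^~ 0) (fun k u e => u.-1) (nth 0 ^~ 1)).
- exact: computable_var.
- by apply: computable_pred; apply: computable_var.
- exact: computable_var.
Qed.

Lemma computable_mul a f g :
  computable a f -> computable a g -> computable a (fun e => f e * g e).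
Proof.
apply: computable_comp2.
apply: (@computable_ext _ (fun e => primrec 0 (fun k u => u + nth 0 e 0) (nth 0 e 1))).
  by move=> e; elim: (nth 0 e 1) => [|k /= ->] /=; lia.
apply: (@computable_primrec 2 (fun=> 0) (fun k u e => u + nth 0 e 0) (nth 0 ^~ 1)).
- exact: computable_const.
- by apply: computable_add; [apply: computable_var|apply: computable_behead2].
- exact: computable_var.
Qed.

Lemma computable_exp a f g :
  computable a f -> computable a g -> computable a (fun e => f e ^ g e).
Proof.
apply: computable_comp2.
apply: (@computable_ext _ (fun e => primrec 1 (fun k u => nth 0 e 0 * u) (nth 0 e 1))).
  by move=> e; elim: (nth 0 e 1) => [|k /= ->] /=; rewrite ?expnS.
apply: (@computable_primrec 2 (fun=> 1) (fun k u e => nth 0 e 0 * u) (nth 0 ^~ 1)).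
- exact: computable_const.
- by apply: computable_mul; [apply: computable_behead2|apply: computable_var].
- exact: computable_var.
Qed.

Lemma computable_not a (f : seq nat -> bool) :
  computable a f -> computable a (fun e => ~~ f e).
Proof.
move=> Cf; apply: (@computable_ext _ (fun e => 1 - f e)).
  by move=> e; case: (f e).
by apply: computable_sub => //; apply: computable_const.
Qed.

Lemma computable_and a (f g : seq nat -> bool) :
  computable a f -> computable a g -> computable a (fun e => f e && g e).
Proof.
move=> Cf Cg; apply: (@computable_ext _ (fun e => f e * g e)).
  by move=> e; case: (f e); case: (g e).
exact: computable_mul.
Qed.

Lemma computable_or a (f g : seq nat -> bool) :
  computable a f -> computable a g -> computable a (fun e => f e || g e).
Proof.
move=> Cf Cg; apply: (@computable_ext _ (fun e => ~~ (~~ f e && ~~ g e))).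
  by move=> e; case: (f e); case: (g e).
by apply: computable_not; apply: computable_and; apply: computable_not.
Qed.

Lemma computable_leq a f g :
  computable a f -> computable a g -> computable a (fun e => f e <= g e).
Proof.
move=> Cf Cg; apply: (@computable_ext _ (fun e => 1 - (f e - g e))).
  by move=> e; lia.
by apply: computable_sub; [apply: computable_const|apply: computable_sub].
Qed.

Lemma computable_eq a f g :
  computable a f -> computable a g -> computable a (fun e => f e == g e).
Proof.
move=> Cf Cg; apply: (@computable_ext _ (fun e => (f e <= g e) && (g e <= f e))).
  by move=> e; rewrite -eqn_leq.
by apply: computable_and; apply: computable_leq.
Qed.

(** * Bounded quantification and bounded search *)

Definition exb (n : nat) (P : pred nat) : bool := has P (iota 0 n).
Definition allb (n : nat) (P : pred nat) : bool := all P (iota 0 n).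
Definition least (n : nat) (P : pred nat) : nat := find P (iota 0 n).

Lemma exbP n (P : pred nat) : reflect (exists2 i, i < n & P i) (exb n P).
Proof.
apply: (iffP hasP) => [[i]|[i lt_in Pi]].
  by rewrite mem_iota => /= lt_in Pi; exists i.
by exists i => //; rewrite mem_iota.
Qed.

Lemma allbP n (P : pred nat) : reflect (forall i, i < n -> P i) (allb n P).
Proof.
apply: (iffP allP) => H i; first by move=> lt_in; apply: H; rewrite mem_iota.
by rewrite mem_iota => /H.
Qed.

(** Uniqueness of the witness replaces minimality: the search serves to invert an injective
    coding. *)
Lemma leastP n (P : pred nat) i :
  i < n -> P i -> (forall j, P j -> j = i) -> least n P = i.
Proof.
move=> lt_in Pi uniq_i; have hasP : has P (iota 0 n).
  by apply/hasP; exists i => //; rewrite mem_iota.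
have := nth_find 0 hasP; rewrite nth_iota ?add0n; first exact: uniq_i.
by rewrite -{2}(size_iota 0 n) -has_find.
Qed.

Lemma computable_exb a (P : nat -> seq nat -> bool) b :
  computable a.+1 (fun e => P (nth 0 e 0) (behead e)) -> computable a b ->
  computable a (fun e => exb (b e) (fun i => P i e)).
Proof.
case=> c cP Cb.
apply: (@computable_ext _
  (fun e => primrec false (fun k u => (u != 0) || P k e) (b e))).
  move=> e; rewrite /exb; elim: (b e) => // k IH.
  by rewrite -addn1 iotaD has_cat addn1 /= IH orbF eqb0 negbK.
apply: (@computable_primrec a (fun=> 0) (fun k u e => (u != 0) || P k e)) => //.
  exact: computable_const.
apply: computable_or.
  apply/computable_not/computable_eq; last exact: computable_const.
  exact: computable_var.
(* The projections skip variable 1, the accumulator, which the code of [P] does not expect. *)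
exists (Comp c (Proj 0 :: [seq Proj i | i <- iota 2 a])) => -[|k [|u e]] //= [sz].
apply: (eval_comp (ys := k :: e)); last by apply: (cP (k :: e)); rewrite /= sz.
  by rewrite /= size_map size_iota sz.
case=> [|i]; first by move=> _; apply: eval_proj.
rewrite /= size_map size_iota ltnS => lt_ia.
rewrite (nth_map 0) ?size_iota // nth_iota // add2n.
by apply: (@eval_proj _ [:: k, u & e]); rewrite /= sz !ltnS.
Qed.

Lemma computable_allb a (P : nat -> seq nat -> bool) b :
  computable a.+1 (fun e => P (nth 0 e 0) (behead e)) -> computable a b ->
  computable a (fun e => allb (b e) (fun i => P i e)).
Proof.
move=> CP Cb; apply: (@computable_ext _
  (fun e => ~~ exb (b e) (fun i => ~~ P i e))).
  by move=> e; rewrite /exb /allb has_predC negbK.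
by apply/computable_not/computable_exb => //; apply: computable_not.
Qed.

Lemma computable_least a (P : nat -> seq nat -> bool) b :
  computable a.+1 (fun e => P (nth 0 e 0) (behead e)) -> computable a b ->
  computable a (fun e => least (b e) (fun i => P i e)).
Proof.
case=> c cP Cb.
(* The accumulator equals the counter as long as no witness has been met, and then stays behind it
   for good. *)
apply: (@computable_ext _
  (fun e => primrec 0 (fun k u => u + ((u == k) && ~~ P k e)) (b e))).
  move=> e; rewrite /least; elim: (b e) => // k.
  rewrite -addn1 iotaD find_cat addn1 [primrec _ _ k.+1]/= => ->.
  rewrite has_find size_iota; case: ltnP => [lt_fk|ge_fk].
    by rewrite ltn_eqF // addn0.
  have -> : find (P^~ e) (iota 0 k) = k.
    by apply/eqP; rewrite eqn_leq ge_fk -{2}(size_iota 0 k) find_size.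
  by rewrite eqxx add0n /=; case: (P k e).
apply: (@computable_primrec a (fun=> 0)
  (fun k u e => u + ((u == k) && ~~ P k e))) => //.
  exact: computable_const.
apply: computable_add; first exact: computable_var.
apply: computable_and; first by apply: computable_eq; apply: computable_var.
apply: computable_not.
exists (Comp c (Proj 0 :: [seq Proj i | i <- iota 2 a])) => -[|k [|u e]] //= [sz].
apply: (eval_comp (ys := k :: e)); last by apply: (cP (k :: e)); rewrite /= sz.
  by rewrite /= size_map size_iota sz.
case=> [|i]; first by move=> _; apply: eval_proj.
rewrite /= size_map size_iota ltnS => lt_ia.
rewrite (nth_map 0) ?size_iota // nth_iota // add2n.
by apply: (@eval_proj _ [:: k, u & e]); rewrite /= sz !ltnS.
Qed.

(** * Arithmetic of sequence codes *)

(** The list constructor on the level of [CodeSeq.code]; it is never zero, so 0 codes the empty list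
    only. *)
Definition consc (x c : nat) : nat := 2 ^ x * (2 * c + 1).

(** Head and tail are smaller than the code, so [c] itself bounds both searches. On 0 the result is
    0, in accordance with the default value of [nth 0]. *)
Definition headc (c : nat) : nat :=
  least c (fun x => exb c (fun d => c == consc x d)).

Definition tailc (c : nat) : nat :=
  least c (fun d => exb c (fun x => c == consc x d)).

Definition dropc (c i : nat) : nat := primrec c (fun _ u => tailc u) i.

Definition nthc (c i : nat) : nat := headc (dropc c i).

Definition sizec (c : nat) : nat := least c (fun i => dropc c i == 0).

Lemma code_cons x s : CodeSeq.code (x :: s) = consc x (CodeSeq.code s).
Proof. by rewrite /consc mul2n addn1. Qed.

Lemma consc_inj x y c d : consc x c = consc y d -> x = y /\ c = d.
Proof.
rewrite -[c]CodeSeq.decodeK -[d]CodeSeq.decodeK -!code_cons.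
by move=> /(can_inj CodeSeq.codeK) [-> ->].
Qed.

Lemma consc_gt x c : x < consc x c /\ c < consc x c.
Proof.
rewrite /consc; split; first by have := ltn_expl x (erefl (1 < 2)); nia.
have : 0 < 2 ^ x by rewrite expn_gt0.
nia.
Qed.

Lemma headc_cons x c : headc (consc x c) = x.
Proof.
have [lt_x lt_c] := consc_gt x c.
apply: leastP => // [|y /exbP[d _ /eqP/consc_inj[]//]].
by apply/exbP; exists c.
Qed.

Lemma tailc_cons x c : tailc (consc x c) = c.
Proof.
have [lt_x lt_c] := consc_gt x c.
apply: leastP => // [|d /exbP[y _ /eqP/consc_inj[]//]].
by apply/exbP; exists x.
Qed.

Lemma dropc_code s i : dropc (CodeSeq.code s) i = CodeSeq.code (drop i s).
Proof.
elim: i => [|i]; first by rewrite drop0.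
rewrite /dropc => /= ->; rewrite -addn1 addnC -drop_drop.
by case: (drop i s) => // x u; rewrite drop1 code_cons tailc_cons.
Qed.

Lemma nthc_code s i : nthc (CodeSeq.code s) i = nth 0 s i.
Proof.
rewrite /nthc dropc_code -[in RHS](addn0 i) -nth_drop.
by case: (drop i s) => // x u; rewrite code_cons headc_cons.
Qed.

Lemma size_code s : size s <= CodeSeq.code s.
Proof.
elim: s => // x s IH; rewrite code_cons [size _]/=.
by have [_] := consc_gt x (CodeSeq.code s); apply: leq_ltn_trans.
Qed.

Lemma code_eq0 s : (CodeSeq.code s == 0) = (s == [::]).
Proof.
case: s => // x s; rewrite code_cons.
by have [/(leq_ltn_trans (leq0n x))] := consc_gt x (CodeSeq.code s); case: consc.
Qed.

Lemma sizec_code s : sizec (CodeSeq.code s) = size s.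
Proof.
rewrite /sizec /least; set P := (P in find P _).
have PE i : P i = (size s <= i).
  by rewrite /P dropc_code code_eq0 -size_eq0 size_drop subn_eq0.
rewrite (eq_find PE).
have : size s <= CodeSeq.code s by exact: size_code.
set n := CodeSeq.code s; move: (size s) => k le_kn {P PE}.
(* If the size equals the code, the range holds no witness and [find] returns the length of the
   range, which is again the size. *)
have [->|lt_kn] := eqVneq k n.
  rewrite hasNfind ?size_iota //; apply/hasPn => i.
  by rewrite mem_iota add0n -ltnNge => /andP[].
have {le_kn}lt_kn : k < n by rewrite ltn_neqAle lt_kn.
have hasP : has (leq k) (iota 0 n) by apply/hasP; exists k; rewrite ?mem_iota /=.
apply/eqP; rewrite eqn_leq; apply/andP; split.
  rewrite leqNgt; apply/negP => /(before_find 0).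
  by rewrite nth_iota // leqnn.
have := nth_find 0 hasP; rewrite nth_iota //.
by rewrite -{2}(size_iota 0 n) -has_find.
Qed.

(** In binary, prepending [x] appends a one and [x] zeros to the code, which makes at most [V] new
    bits per entry. *)
Lemma code_bound V s L :
  size s <= L -> all (gtn V) s -> CodeSeq.code s < 2 ^ (V.+1 * L).
Proof.
elim: s L => [|x s IH] [|L] //; rewrite ?expn_gt0 // [size _]/= ltnS.
move=> /IH{}IH /andP[lt_xV /IH{}IH]; rewrite code_cons /consc mulnS expnD.
have le1 : 2 ^ x * 2 <= 2 ^ V by rewrite -expnSr leq_exp2l.
rewrite [2 ^ V.+1]expnS; set c := CodeSeq.code s in IH *.
set u := 2 ^ x in le1 *; set v := 2 ^ V in le1 *; set w := 2 ^ _ in IH *.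
have : 0 < u by rewrite expn_gt0.
nia.
Qed.

Lemma computable_consc a f g :
  computable a f -> computable a g -> computable a (fun e => consc (f e) (g e)).
Proof.
move=> Cf Cg; rewrite /consc; apply: computable_mul.
  by apply: computable_exp => //; apply: computable_const.
apply: computable_add; last exact: computable_const.
by apply: computable_mul => //; apply: computable_const.
Qed.

Lemma computable_headc a f : computable a f -> computable a (fun e => headc (f e)).
Proof.
apply: computable_comp1; rewrite /headc.
apply: computable_least; last exact: computable_var.
apply: computable_exb; last exact: computable_behead1.
apply: computable_eq; first exact: computable_behead2.
by apply: computable_consc; [apply: computable_behead1|apply: computable_var].
Qed.

Lemma computable_tailc a f : computable a f -> computable a (fun e => tailc (f e)).
Proof.
apply: computable_comp1; rewrite /tailc.
apply: computable_least; last exact: computable_var.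
apply: computable_exb; last exact: computable_behead1.
apply: computable_eq; first exact: computable_behead2.
by apply: computable_consc; [apply: computable_var|apply: computable_behead1].
Qed.

Lemma computable_dropc a f g :
  computable a f -> computable a g -> computable a (fun e => dropc (f e) (g e)).
Proof.
move=> Cf Cg; apply: (@computable_primrec a f (fun _ u _ => tailc u) g) => //.
by apply: computable_tailc; apply: computable_var.
Qed.

Lemma computable_nthc a f g :
  computable a f -> computable a g -> computable a (fun e => nthc (f e) (g e)).
Proof. by move=> Cf Cg; apply: computable_headc; apply: computable_dropc. Qed.

Lemma computable_sizec a f : computable a f -> computable a (fun e => sizec (f e)).
Proof.
apply: computable_comp1; rewrite /sizec.
apply: computable_least; last exact: computable_var.
apply: computable_eq; last exact: computable_const.
by apply: computable_dropc; [apply: computable_behead1|apply: computable_var].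
Qed.

Ltac computability :=
  repeat first
  [ by apply: computable_var | by apply: computable_behead1
  | by apply: computable_behead2 | by apply: computable_behead3
  | exact: computable_const | assumption
  | apply: computable_and | apply: computable_or | apply: computable_not
  | apply: computable_eq | apply: computable_leq
  | apply: computable_consc | apply: computable_nthc | apply: computable_sizec
  | apply: computable_dropc | apply: computable_tailc | apply: computable_headc
  | apply: computable_exp | apply: computable_mul | apply: computable_add
  | apply: computable_sub | apply: computable_succ ].

(** * Walks and cuts *)

Definition height (m : nat) (s : store m) : nat := size (below s).

Definition monotone (m : nat) (d : bool) (tr : seq (action m)) : bool :=
  all (fun c => direction c != Some (~~ d)) tr.

Lemma height_do_action m (c : action m) s s1 :
  do_action c s = Some s1 ->
  match direction c with
  | Some true => height s1 = (height s).+1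
  | Some false => height s = (height s1).+1
  | None => s1 = s
  end.
Proof.
by case: c s => [g||||] [[|x b] [|y t]] //= [<-].
Qed.

(** Alphabet, states and transitions are parameters because walks serve both for [M] and for its
    product with a word matcher. The bounds on the height allow a walk to be confined to one side of
    a cut. *)
Inductive walk (A Q : Type) (m : nat)
    (delta : Q -> option 'I_m -> bool -> action m -> option A -> Q -> Prop)
    (lo hi : nat) :
    Q -> store m -> seq A -> seq (action m) -> Q -> store m -> Prop :=
| walk_nil q s : lo <= height s <= hi -> walk delta lo hi q s [::] [::] q s
| walk_cons q s c o q1 s1 w tr q' s' :
    lo <= height s <= hi ->
    delta q (ohead (below s)) (nilp (above s)) c o q1 ->
    do_action c s = Some s1 ->
    walk delta lo hi q1 s1 w tr q' s' ->
    walk delta lo hi q s (seq_of_opt o ++ w) (c :: tr) q' s'.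

Section Walks.

Variables (A Q : Type) (m : nat).
Variable delta : Q -> option 'I_m -> bool -> action m -> option A -> Q -> Prop.
Implicit Types (s : store m) (p q : Q) (w : seq A) (tr : seq (action m)).

Local Notation walk := (walk delta).

Lemma walk_head lo hi q s w tr q' s' :
  walk lo hi q s w tr q' s' -> lo <= height s <= hi.
Proof. by case. Qed.

Lemma walk_last lo hi q s w tr q' s' :
  walk lo hi q s w tr q' s' -> lo <= height s' <= hi.
Proof. by elim. Qed.

Lemma walk_widen lo hi lo' hi' q s w tr q' s' :
  lo' <= lo -> hi <= hi' ->
  walk lo hi q s w tr q' s' -> walk lo' hi' q s w tr q' s'.
Proof.
move=> le_lo le_hi; elim=> {q s w tr q' s'} [q s /andP[? ?]|].
  by constructor; lia.
move=> q s c o q1 s1 w tr q' s' /andP[? ?] dq dos _ IH.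
by apply: walk_cons dq dos IH; lia.
Qed.

Lemma walk_cat lo hi q s w tr q1 s1 w1 tr1 q' s' :
  walk lo hi q s w tr q1 s1 -> walk lo hi q1 s1 w1 tr1 q' s' ->
  walk lo hi q s (w ++ w1) (tr ++ tr1) q' s'.
Proof.
elim=> {q s w tr q1 s1} // q s c o q2 s2 w tr q1 s1 hs dq dos _ IH /IH{}IH.
by rewrite -catA; apply: walk_cons IH.
Qed.

Lemma walk_cat_trace lo hi q s w tr1 tr2 q' s' :
  walk lo hi q s w (tr1 ++ tr2) q' s' ->
  exists w1 w2 q1 s1, [/\ w = w1 ++ w2, walk lo hi q s w1 tr1 q1 s1
    & walk lo hi q1 s1 w2 tr2 q' s'].
Proof.
elim: tr1 q s w => [|c tr1 IH] q s w /= W.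
  by exists [::], w, q, s; split=> //; constructor; apply: walk_head W.
inversion W as [|? ? ? o q1 s1 w1 ? ? ? hs dq dos W1]; subst.
have [w2 [w3 [q2 [s2 [-> W2 W3]]]]] := IH _ _ _ W1.
exists (seq_of_opt o ++ w2), w3, q2, s2; split=> //; first by rewrite catA.
exact: walk_cons dq dos W2.
Qed.

Lemma walk_cat_word lo hi q s w1 w2 tr q' s' :
  walk lo hi q s (w1 ++ w2) tr q' s' ->
  exists tr1 tr2 q1 s1, [/\ tr = tr1 ++ tr2, walk lo hi q s w1 tr1 q1 s1
    & walk lo hi q1 s1 w2 tr2 q' s'].
Proof.
move E: (w1 ++ w2) => w W; elim: W w1 E => {q s w tr q' s'} [q s hs|].
  case=> //= ->; exists [::], [::], q, s; split=> //; exact: walk_nil.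
move=> q s c o q1 s1 w tr q' s' hs dq dos W IH [|a w1] E.
  exists [::], (c :: tr), q, s; split=> //; first exact: walk_nil.
  by rewrite [w2]E; apply: walk_cons W.
case: o => [x|] /= in dq E.
  case: E => -> /IH[tr1 [tr2 [q2 [s2 [-> W1 W2]]]]].
  exists (c :: tr1), tr2, q2, s2; split=> //.
  exact: (walk_cons hs dq dos W1).
have [tr1 [tr2 [q2 [s2 [-> W1 W2]]]]] := IH (a :: w1) E.
exists (c :: tr1), tr2, q2, s2; split=> //.
exact: (walk_cons hs dq dos W1).
Qed.

Lemma walk_monotone_up lo hi q s w tr q' s' :
  monotone true tr -> walk lo hi q s w tr q' s' ->
  height s <= height s' /\ walk (height s) (height s') q s w tr q' s'.
Proof.
move=> mon W; elim: W mon => {q s w tr q' s'} [q s _ _|].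
  by split=> //; constructor; rewrite leqnn.
move=> q s c o q1 s1 w tr q' s' _ dq dos _ IH /= /andP[dc /IH[le_s1 W]].
have le_s : height s <= height s1.
  move: (height_do_action dos) dc.
  by case: (direction c) => [[]|] // => [-> _|-> _].
split; first exact: leq_trans le_s1.
apply: walk_cons dq dos _; first by rewrite leqnn (leq_trans le_s).
exact: walk_widen W.
Qed.

Lemma walk_monotone_down lo hi q s w tr q' s' :
  monotone false tr -> walk lo hi q s w tr q' s' ->
  height s' <= height s /\ walk (height s') (height s) q s w tr q' s'.
Proof.
move=> mon W; elim: W mon => {q s w tr q' s'} [q s _ _|].
  by split=> //; constructor; rewrite leqnn.
move=> q s c o q1 s1 w tr q' s' _ dq dos _ IH /= /andP[dc /IH[le_s1 W]].
have le_s : height s1 <= height s.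
  move: (height_do_action dos) dc.
  by case: (direction c) => [[]|] // => [-> _|-> _].
split; first exact: leq_trans le_s.
apply: walk_cons dq dos _; first by rewrite leqnn (leq_trans le_s1).
exact: walk_widen W.
Qed.

Lemma walk_monotone lo hi q s w tr q' s' d :
  monotone d tr -> walk lo hi q s w tr q' s' ->
  walk (minn (height s) (height s')) (maxn (height s) (height s')) q s w tr q' s'.
Proof.
case: d => mon W.
  have [le_h W'] := walk_monotone_up mon W.
  by rewrite (minn_idPl le_h) (maxn_idPr le_h).
have [le_h W'] := walk_monotone_down mon W.
by rewrite (minn_idPr le_h) (maxn_idPl le_h).
Qed.

(** A discrete intermediate value property: one action changes the height by at most one. *)
Lemma walk_cross lo hi h q s w tr q' s' :
  walk lo hi q s w tr q' s' ->
  height s <= h <= height s' \/ height s' <= h <= height s ->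
  exists w1 w2 tr1 tr2 q1 s1, [/\ tr = tr1 ++ tr2, height s1 = h,
    walk lo hi q s w1 tr1 q1 s1 & walk lo hi q1 s1 w2 tr2 q' s'].
Proof.
elim=> {q s w tr q' s'} [q s hs|].
  move=> le_h; exists [::], [::], [::], [::], q, s.
  by split=> //; [lia|constructor|constructor].
move=> q s c o q1 s1 w tr q' s' hs dq dos W IH le_h.
have [eq_h|neq_h] := eqVneq (height s) h.
  exists [::], (seq_of_opt o ++ w), [::], (c :: tr), q, s; split=> //.
    by constructor.
  exact: walk_cons W.
have [|w1 [w2 [tr1 [tr2 [q2 [s2 [-> <- W1 W2]]]]]]] := IH.
  have := height_do_action dos; case: (direction c) => [[]|]; try lia.
  by move=> eq_s; subst; lia.
exists (seq_of_opt o ++ w1), w2, (c :: tr1), tr2, q2, s2; split=> //.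
exact: walk_cons W1.
Qed.

(* The tape is cut at height [h]: [z] is the part of the store below the cut and
   [y] the part above it.  Whichever side does not contain the head has the
   empty list as its component facing the head. *)
Definition join (z y : seq 'I_m * seq 'I_m) : store m :=
  Store (y.1 ++ z.1) (z.2 ++ y.2).

(** The first condition is an inequality because the stack may end below the cut; the other two then
    force [y] to be empty. *)
Definition cut_at (h : nat) (z y : seq 'I_m * seq 'I_m) : Prop :=
  [/\ size z.1 + size z.2 <= h, 0 < size y.1 -> size z.1 = h
    & 0 < size y.2 -> size z.1 + size z.2 = h].

(* A run below the cut sees of the part above only whether it is empty, and a run
   above the cut sees only the nearest symbol below: they remain runs when the
   other part is replaced. *)
Definition lseg (h : nat) (w : seq A) (tr : seq (action m)) (f : bool) p z p' z' :=
  forall a, nilp a = f -> walk 0 h p (join z ([::], a)) w tr p' (join z' ([::], a)).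

Definition rseg (D : nat) (w : seq A) (tr : seq (action m)) (g : option 'I_m)
    p y p' y' :=
  forall b, ohead b = g ->
    walk 0 (D + size b) p (join (b, [::]) y) w tr p' (join (b, [::]) y').

(** The height bound excludes a push at the cut and a move up into [y.2]. The upper part is
    consulted only by the test for the top of the stack, that is, through its emptiness. *)
Lemma walk_below lo h q z y w tr q' s' :
  cut_at h z y -> walk lo h q (join z y) w tr q' s' ->
  y.1 = [::] /\ exists z', [/\ s' = join z' y, cut_at h z' y
    & lseg h w tr (nilp y.2) q z q' z'].
Proof.
case: z y => b t [t2 a] cut W.
have t2_nil : t2 = [::].
  case: cut (walk_head W) => /= _; rewrite /height /= size_cat.
  by case: t2 {W} => //= x t2 /(_ isT) size_b _ hs; exfalso; lia.
subst t2; split=> //; move E: (join _ _) W => s W.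
elim: W b t cut E => {q s w tr q' s'} [q s hs|].
  move=> b t cut <-; exists (b, t); split=> // a2 fa2.
  by constructor; case: cut; rewrite /height /=; lia.
move=> q s c o q1 s1 w tr q' s' hs dq dos W IH b t cut E; subst s.
have [b1 [t1 [cut1 E1 loc]]] : exists b1 t1, [/\ cut_at h (b1, t1) ([::], a),
    join (b1, t1) ([::], a) = s1
  & forall a2, nilp a2 = nilp a -> do_action c (join (b, t) ([::], a2)) =
      Some (join (b1, t1) ([::], a2))].
  case: cut (walk_head W) dos; rewrite /= /height /join /= => cut _ cuta.
  case: c {dq} => [g||||] /=.
  - case: t a cut cuta {W IH hs} => [|x t] [|x' a] //= cut _ lt_s1 [] Es.
    subst s1; rewrite /= in lt_s1; exists (g :: b), [::]; split=> //=; last by case.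
    by split=> //=; lia.
  - case: b t a cut cuta {W IH hs} => [|g b] [|x t] [|x' a] //= cut _ lt_s1 [] Es.
    subst s1; rewrite /= in lt_s1; exists b, [::]; split=> //=; last by case.
    by split=> //=; lia.
  - case: b cut cuta {W IH hs} => [|g b] //= cut cuta lt_s1 [] Es.
    subst s1; rewrite /= in lt_s1; exists b, (g :: t); split=> //=; split=> //=; lia.
  - case: t cut cuta {W IH hs} => [|x t] /= cut cuta lt_s1.
      by case: a cuta => //= x a cuta [] Es; move: lt_s1; rewrite -Es /=; lia.
    move=> [] Es; subst s1; rewrite /= in lt_s1.
    exists (x :: b), t; split=> //=.
    by split=> //=; lia.
  - by move=> _ [] Es; subst s1; exists b, t.
have [z' [-> cut' L]] := IH _ _ cut1 E1.
exists z'; split=> // a2 fa2; apply: walk_cons (loc _ fa2) (L _ fa2).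
  by case: cut => /=; rewrite /height /=; lia.
move: dq; rewrite /= !/nilp !size_cat !addn_eq0.
by move: fa2; rewrite /nilp => ->.
Qed.

(** Dually, a pop or a move down at height [h] is excluded, so the lower part stays fixed and at
    most its nearest symbol, or the bottom marker, is scanned. *)
Lemma walk_above h hi q z y w tr q' s' :
  cut_at h z y -> walk h hi q (join z y) w tr q' s' ->
  [/\ z.2 = [::], size z.1 = h & exists y', [/\ s' = join z y', cut_at h z y'
    & rseg (hi - h) w tr (ohead z.1) q y q' y']].
Proof.
case: z y => b t [t2 a] cut W.
have [t_nil size_b] : t = [::] /\ size b = h.
  case: cut (walk_head W) => /=; rewrite /height /= size_cat => le_h t2h _ ge_h.
  have [/size0nil ? ?] : size t = 0 /\ size b = h by split; lia.
  by [].
subst t; split=> //; move E: (join _ _) W => s W.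
have cutT t1 a1 : cut_at h (b, [::]) (t1, a1) by split=> //=; lia.
elim: W t2 a {cut} E => {q s w tr q' s'} [q s hs|].
  move=> t a Es; subst s; exists (t, a); split=> // b2 _.
  by constructor; move: hs; rewrite /height /= !size_cat; lia.
move=> q s c o q1 s1 w tr q' s' hs dq dos W IH t a E; subst s.
have [t1 [a1 [E1 loc]]] : exists t1 a1, join (b, [::]) (t1, a1) = s1 /\
    forall b2, do_action c (join (b2, [::]) (t, a)) = Some (join (b2, [::]) (t1, a1)).
  move: (walk_head W) dos; rewrite /= /height /join /=.
  case: c {dq} => [g||||] /=.
  - case: a {W IH hs} => //= _ [] <-.
    by exists (g :: t), [::]; split.
  - case: t {W IH hs} => [|x t] /=.
      case: b {cutT} size_b => //= x b size_b; case: a => //= + [] Es.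
      by rewrite -Es /=; lia.
    case: a => // _ [] <-.
    by exists t, [::].
  - case: t {W IH hs} => [|x t] /=.
      by case: b {cutT} size_b => //= x b size_b + [] Es; rewrite -Es /=; lia.
    by move=> _ [] <-; exists t, (x :: a).
  - case: a {W IH hs} => [|x a]; first by case: (t ++ b).
    move=> /= lt Es; have {}Es : Store ((x :: t) ++ b) a = s1.
      by move: Es; case: (t ++ b) (cat_cons x t b) => [|? ?] -> [].
    by exists (x :: t), a; split=> // b2; rewrite /join /=; case: (t ++ b2).
  - by move=> _ [] <-; exists t, a.
have [y' [-> cut' R]] := IH _ _ E1.
exists y'; split=> // b2 hb2; apply: walk_cons (loc _) (R _ hb2).
  by move: hs; rewrite /height /= !size_cat; lia.
move: dq => /=; have -> // : ohead (t ++ b2) = ohead (t ++ b).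
by case: (t).
Qed.

End Walks.

(** * Gluing *)

Definition unidirectional (m : nat) (tr : seq (action m)) : bool :=
  monotone true tr || monotone false tr.

Lemma unidirectionalP m (tr : seq (action m)) :
  reflect (exists d, monotone d tr) (unidirectional tr).
Proof.
by apply: (iffP orP) => [[]|[[]]]; [exists true|exists false|left|right].
Qed.

(** A turn at the junction is counted only in the concatenation, hence the inequality. *)
Lemma reversals_cat m (tr1 tr2 : seq (action m)) :
  reversals tr1 + reversals tr2 <= reversals (tr1 ++ tr2).
Proof.
rewrite /reversals pmap_cat; case: (pmap _ tr1) => //= d ds1.
rewrite pairmap_cat count_cat leq_add2l.
by case: (pmap _ tr2) => //= d' ds2; apply: leq_addl.
Qed.

Lemma reversals_pieces m (tr : seq (action m)) :
  exists trs, [/\ size trs = (reversals tr).+1, flatten trs = tr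
    & all (@unidirectional m) trs].
Proof.
(* To prolong the first piece to the left, the induction must know its direction: the first one
   occurring in [tr], and both if the head never moves. *)
suff [t [ts [Etr Ets ut uts _]]] : exists t ts,
    [/\ flatten (t :: ts) = tr, size ts = reversals tr, unidirectional t,
        all (@unidirectional m) ts
      & forall d, head d (pmap (@direction m) tr) = d -> monotone d t].
  by exists (t :: ts); split=> /=; rewrite ?Ets ?ut.
elim: tr => [|c tr [t [ts [Etr Ets ut uts tP]]]]; first by exists [::], [::].
rewrite /= in Etr; rewrite /reversals /=; case Dc: (direction c) => [d|] /=.
  have mono_c : monotone d [:: c] by rewrite /= Dc; case: (d).
  have mono_cons : monotone d t -> monotone d (c :: t).
    by move: mono_c => /= /andP[-> _].
  case Ed: (pmap _ tr) tP => [|d' ds] /= tP.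
    exists (c :: t), ts; split=> //=; first by rewrite Etr.
    - by rewrite Ets /reversals Ed.
    - by apply/unidirectionalP; exists d; apply: mono_cons; apply: tP.
    - by move=> d0 <-; apply: mono_cons; apply: tP.
  have Erev : reversals tr = count id (pairmap addb d' ds) by rewrite /reversals Ed.
  have [eq_d|neq_d] := eqVneq d d'.
    exists (c :: t), ts; split=> //=; first by rewrite Etr.
    - by rewrite Ets Erev eq_d addbb.
    - by apply/unidirectionalP; exists d; apply: mono_cons; apply: tP.
    - by move=> d0 <-; apply: mono_cons; apply: tP.
  exists [:: c], (t :: ts); split=> //=; first by rewrite Etr.
  - by rewrite Ets Erev (_ : d (+) d' = true) //; case: (d) (d') neq_d => [] [].
  - by apply/unidirectionalP; exists d.
  - by rewrite ut.
  - by move=> d0 <-.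
have mono_cons d : monotone d t -> monotone d (c :: t) by rewrite /= Dc.
exists (c :: t), ts; split=> //=; first by rewrite Etr.
- case/unidirectionalP: ut => d /mono_cons mono_ct.
  by apply/unidirectionalP; exists d.
- by move=> d /tP; apply: mono_cons.
Qed.

Lemma reversals_eq0 m (tr : seq (action m)) :
  reversals tr = 0 -> exists d, monotone d tr.
Proof.
move=> tr0; have [[|t [|? ?]] [//]] := reversals_pieces tr; rewrite tr0 //= cats0.
by move=> _ -> /andP[/unidirectionalP].
Qed.

(* [inl g]: the head stays above the cut, whose nearest symbol below is [g];
   [inr f]: the head stays below the cut, and [f] tells whether the part above is
   empty.  The states are those at the two ends of the episode. *)
Definition episode (Q : Type) (m : nat) : Type :=
  ((option 'I_m + bool) * Q * Q)%type.

Section Halves.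

Variables (A Q : Type) (m : nat).
Variable delta : Q -> option 'I_m -> bool -> action m -> option A -> Q -> Prop.

Local Notation walk := (walk delta).
Local Notation lseg := (lseg delta).
Local Notation rseg := (rseg delta).
Local Notation zipper := (seq 'I_m * seq 'I_m)%type.

Fixpoint linked (p : Q) (sg : seq (episode Q m)) (p' : Q) : Prop :=
  if sg is (_, q, q') :: sg' then p = q /\ linked q' sg' p' else p = p'.

(** The run as seen from the lower part: an actual run in an episode below, and in an episode above
    an unchanged store showing [g] at the cut. Words and traces are forgotten, so that halves of
    different runs can be compared by their episodes alone. *)
Fixpoint lhalf (h : nat) (sg : seq (episode Q m)) (z z' : zipper) : Prop :=
  match sg with
  | [::] => z = z'
  | (inr f, p, p') :: sg' =>
    exists w tr z1, lseg h w tr f p z p' z1 /\ lhalf h sg' z1 z'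
  | (inl g, p, p') :: sg' =>
    [/\ z.2 = [::], ohead z.1 = g, size z.1 = h & lhalf h sg' z z']
  end.

Fixpoint rhalf (D : nat) (sg : seq (episode Q m)) (y y' : zipper) : Prop :=
  match sg with
  | [::] => y = y'
  | (inr f, p, p') :: sg' => [/\ y.1 = [::], nilp y.2 = f & rhalf D sg' y y']
  | (inl g, p, p') :: sg' =>
    exists w tr y1, rseg D w tr g p y p' y1 /\ rhalf D sg' y1 y'
  end.

Lemma linked_cat p sg1 q sg2 p' :
  linked p sg1 q -> linked q sg2 p' -> linked p (sg1 ++ sg2) p'.
Proof.
elim: sg1 p => [|[[i p1] p2] sg IH] p /=; first by move=> ->.
by move=> [-> L1] L2; split=> //; apply: IH.
Qed.

Lemma lhalf_cat h sg1 sg2 z z1 z' :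
  lhalf h sg1 z z1 -> lhalf h sg2 z1 z' -> lhalf h (sg1 ++ sg2) z z'.
Proof.
elim: sg1 z => [|[[[g|f] p1] p2] sg IH] z /=; first by move=> ->.
  by move=> [? ? ? L1] L2; split=> //; apply: IH.
move=> [w [tr [z2 [L L1]]]] L2.
by exists w, tr, z2; split=> //; apply: IH.
Qed.

Lemma rhalf_cat D sg1 sg2 y y1 y' :
  rhalf D sg1 y y1 -> rhalf D sg2 y1 y' -> rhalf D (sg1 ++ sg2) y y'.
Proof.
elim: sg1 y => [|[[[g|f] p1] p2] sg IH] y /=; first by move=> ->.
  move=> [w [tr [y2 [L R1]]]] R2.
  by exists w, tr, y2; split=> //; apply: IH.
by move=> [? ? R1] R2; split=> //; apply: IH.
Qed.

(** Each episode is carried out by one half next to the other half as it currently stands, of which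
    it sees only [g] or [f]. As [D] is measured from the cut, the halves may stem from cuts at
    different heights. *)
Lemma glue h D sg p z y p' z' y' :
  linked p sg p' -> lhalf h sg z z' -> rhalf D sg y y' ->
  height (join z y) <= h + D ->
  exists w tr, walk 0 (h + D) p (join z y) w tr p' (join z' y').
Proof.
elim: sg p z y => [|[[[g|f] p1] p2] sg IH] p z y /=.
- by move=> -> -> -> hs; exists [::], [::]; constructor.
- move=> [-> lk] [z_nil z_head z_size L] [w [tr [y1 [R Rs]]]] hs.
  have W := R _ z_head; rewrite z_size -z_nil -surjective_pairing addnC in W.
  have /andP[_ hs1] := walk_last W.
  have [w2 [tr2 W2]] := IH _ _ _ lk L Rs hs1.
  by exists (w ++ w2), (tr ++ tr2); apply: walk_cat W W2.
- move=> [-> lk] [w [tr [z1 [Lg Ls]]]] [y_nil y_nilp R] hs.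
  have W := Lg _ y_nilp; rewrite -y_nil -surjective_pairing in W.
  have {}W := walk_widen (leqnn 0) (leq_addr D h) W.
  have /andP[_ hs1] := walk_last W.
  have [w2 [tr2 W2]] := IH _ _ _ lk Ls R hs1.
  by exists (w ++ w2), (tr ++ tr2); apply: walk_cat W W2.
Qed.

Lemma one_sided_halves lo hi X h q z y w tr q' s' :
  cut_at h z y -> walk lo hi q (join z y) w tr q' s' -> hi <= X ->
  hi <= h \/ h <= lo ->
  exists e z' y', [/\ s' = join z' y', cut_at h z' y', linked q [:: e] q',
    lhalf h [:: e] z z' & rhalf (X - h) [:: e] y y'].
Proof.
move=> cut W le_hiX [le_hi|le_lo].
  have [y_nil [z' [-> cut' L]]] := walk_below cut (walk_widen (leq0n _) le_hi W).
  exists (inr (nilp y.2), q, q'), z', y; split=> //=.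
  by exists w, tr, z'.
have [z_nil z_size [y' [-> cut' R]]] := walk_above cut (walk_widen le_lo le_hiX W).
exists (inl (ohead z.1), q, q'), z, y'; split=> //=.
by exists w, tr, y'.
Qed.

(** A unidirectional piece passes height [h] at most once, so it splits into at most two one-sided
    episodes. *)
Lemma walk_halves X h trs q z y w q' s' :
  all (@unidirectional m) trs -> cut_at h z y ->
  walk 0 X q (join z y) w (flatten trs) q' s' ->
  exists sg z' y', [/\ size sg <= 2 * size trs, s' = join z' y', cut_at h z' y',
    linked q sg q' & lhalf h sg z z' /\ rhalf (X - h) sg y y'].
Proof.
elim: trs q z y w => [|tr trs IH] q z y w /=.
  move=> _ cut W; inversion W; subst.
  by exists [::], z, y.
move=> /andP[/unidirectionalP[d mon] mons] cut W.
have [w1 [w2 [q1 [s1 [_ W1 W2]]]]] := walk_cat_trace W.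
suff [sg1 [z1 [y1 [le_sg1 Es1 cut1 lk1 [L1 R1]]]]] : exists sg z1 y1,
    [/\ size sg <= 2, s1 = join z1 y1, cut_at h z1 y1, linked q sg q1
      & lhalf h sg z z1 /\ rhalf (X - h) sg y y1].
  subst s1; have [sg2 [z2 [y2 [le_sg2 Es2 cut2 lk2 [L2 R2]]]]] := IH _ _ _ _ mons cut1 W2.
  exists (sg1 ++ sg2), z2, y2; split=> //; first by rewrite size_cat mulnS leq_add.
    exact: linked_cat lk2.
  by split; [apply: lhalf_cat L2|apply: rhalf_cat R2].
have M1 := walk_monotone mon W1.
have /andP[_ leX] := walk_head W1; have /andP[_ leX'] := walk_last W1.
have le_max : maxn (height (join z y)) (height s1) <= X by rewrite geq_max leX.
have one_side : maxn (height (join z y)) (height s1) <= h \/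
    h <= minn (height (join z y)) (height s1) ->
    exists sg z1 y1, [/\ size sg <= 2, s1 = join z1 y1, cut_at h z1 y1,
      linked q sg q1 & lhalf h sg z z1 /\ rhalf (X - h) sg y y1].
  move=> side; have [e [z1 [y1 [? ? ? ? ?]]]] := one_sided_halves cut M1 le_max side.
  by exists [:: e], z1, y1.
have [le_h|] := leqP (maxn (height (join z y)) (height s1)) h.
  by apply: one_side; left.
have [ge_h|] := leqP h (minn (height (join z y)) (height s1)).
  by move=> _; apply: one_side; right.
move=> lt_min lt_max.
(* Neither side contains the whole piece, so its ends lie strictly on opposite sides of the cut. *)
have crosses : height (join z y) <= h <= height s1 \/ height s1 <= h <= height (join z y).
  by lia.
have [u1 [u2 [t1 [t2 [q2 [s2 [Et hs2 V1 V2]]]]]]] := walk_cross W1 crosses.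
move: mon; rewrite Et /monotone all_cat => /andP[mon1 mon2].
have {}V1 := walk_monotone mon1 V1; have {}V2 := walk_monotone mon2 V2.
rewrite hs2 in V1 V2.
have [|| e1 [z1 [y1 [Es2 cut1 lk1 L1 R1]]]] := one_sided_halves (X := X) cut V1.
- by lia.
- by lia.
subst s2.
have [|| e2 [z2 [y2 [Es1 cut2 lk2 L2 R2]]]] := one_sided_halves (X := X) cut1 V2.
- by lia.
- by lia.
exists ([:: e1] ++ [:: e2]), z2, y2; split=> //; first exact: linked_cat lk2.
by split; [apply: lhalf_cat L2|apply: rhalf_cat R2].
Qed.

End Halves.

(** * Short accepting runs *)

(** Padding makes lists of bounded length into elements of a finite type; overcounting them is
    harmless, since only upper bounds are wanted. *)
Lemma pad_tuple (T : Type) (K : nat) (s : seq T) :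
  size s <= K -> exists t : K.-tuple (option T), pmap id t = s.
Proof.
move=> le_sK; have sz : size (map some s ++ nseq (K - size s) None) == K.
  by rewrite size_cat size_map size_nseq subnKC.
exists (Tuple sz) => /=; rewrite pmap_cat (_ : pmap id (nseq _ _) = [::]); last first.
  by elim: (K - size s).
by rewrite cats0; elim: s {le_sK sz} => //= x s ->.
Qed.

Lemma pigeonhole (T : finType) (N : nat) (R : nat -> T -> Prop) :
  #|T| < N -> (forall i, i < N -> exists x, R i x) ->
  exists i j x, [/\ i < j, j < N, R i x & R j x].
Proof.
move=> ltTN RN.
have [f fP] := fin_all_exists (fun i : 'I_N => RN i (ltn_ord i)).
have [i [j neq_ij eq_f]] : exists i, exists2 j, i != j & f i = f j.
  apply/injectivePn; apply/negP => /injectiveP/leq_card.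
  by rewrite card_ord leqNgt ltTN.
case: (ltngtP i j) neq_ij => [lt_ij|lt_ji|/val_inj->]; last by rewrite eqxx.
  by exists i, j, (f i); split=> //; rewrite eq_f.
by exists j, i, (f i); split=> //; rewrite eq_f.
Qed.

(** An episode has [m.+1 + 2] kinds and two states; the outer successor accounts for the padding,
    and the exponent for two episodes in each of [l.+1] unidirectional pieces. *)
Definition summary_count (q m l : nat) : nat :=
  ((m.+1 + 2) * q * q).+1 ^ (2 * l.+1).

Lemma card_episodes (Q : finType) (m l : nat) :
  #|{: (2 * l.+1).-tuple (option (episode Q m))}| = summary_count #|Q| m l.
Proof.
by rewrite card_tuple card_option !card_prod card_sum card_option card_ord card_bool.
Qed.

Section ShortRuns.

Variables (A : Type) (Q : finType) (m : nat).
Variable delta : Q -> option 'I_m -> bool -> action m -> option A -> Q -> Prop.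
Variables (q0 : Q) (accept : Q -> Prop).

Local Notation empty := (Store [::] [::] : store m).

Definition accepts_within (X : nat) : Prop :=
  exists w tr q s, accept q /\ walk delta 0 X q0 empty w tr q s.

(** If the heights below [X] outnumber the summaries, cuts at some [i < j] have the same one. Gluing
    the part below [i] to the part above [j] gives an accepting walk within [i + (X - j) < X]; the
    word may change, but only acceptance matters. *)
Lemma accepts_within_low (l X : nat) :
  (forall X w tr q s, accept q -> walk delta 0 X q0 empty w tr q s ->
     reversals tr <= l) ->
  accepts_within X -> accepts_within (summary_count #|Q| m l).
Proof.
move=> rev_l; elim/ltn_ind: X => X IH [w [tr [q [s [acc W]]]]].
have [le_X|lt_X] := leqP X (summary_count #|Q| m l).
  by exists w, tr, q, s; split=> //; apply: walk_widen W.
have [trs [sz_trs flat_trs uni_trs]] := reversals_pieces tr.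
pose R h (t : (2 * l.+1).-tuple (option (episode Q m))) :=
  exists z y, [/\ linked q0 (pmap id t) q,
    lhalf delta h (pmap id t) ([::], [::]) z
    & rhalf delta (X - h) (pmap id t) ([::], [::]) y].
have [i [j [t [lt_ij ltjX [z [_ [lk L _]]] [_ [y [_ _ R']]]]]]] : exists i j t,
    [/\ i < j, j < X, R i t & R j t].
  apply: pigeonhole => [|h _]; first by rewrite card_episodes.
  have cut0 : cut_at h (([::], [::]) : seq 'I_m * seq 'I_m) ([::], [::]) by [].
  rewrite -flat_trs in W.
  have [sg [z [y [le_sg _ _ lk [L R']]]]] := walk_halves uni_trs cut0 W.
  have [|t Et] := @pad_tuple _ (2 * l.+1) sg; last by exists t, z, y; rewrite Et.
  by apply: leq_trans le_sg _; rewrite sz_trs leq_mul2l ltnS -flat_trs; apply: rev_l acc W.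
have [//|w1 [tr1 W1]] := glue lk L R'.
apply: (IH (i + (X - j))); first by lia.
by exists w1, tr1, q, (join z y).
Qed.

(** * Bounding the number of steps *)

Local Notation conf := (Q * seq 'I_m * seq 'I_m)%type.

Definition store_of (c : conf) : store m := Store c.1.2 c.2.

Definition conf_step (c c' : conf) : Prop :=
  exists a o, delta c.1.1 (ohead c.1.2) (nilp c.2) a o c'.1.1 /\
    do_action a (store_of c) = Some (store_of c').

Definition fits (X : nat) (c : conf) : bool :=
  (size c.1.2 <= X) && (size c.2 <= X).

Lemma walk_confs X q s w tr q' s' :
  walk delta 0 X q s w tr q' s' -> size (below s) + size (above s) <= X ->
  exists p, [/\ path (fun c c' => `[< conf_step c c' >]) (q, below s, above s) p,
    last (q, below s, above s) p = (q', below s', above s')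
    & all (fits X) ((q, below s, above s) :: p)].
Proof.
elim=> {q s w tr q' s'} [q s hs|q s c o q1 s1 w tr q' s' hs dq dos W IH] sz.
  by exists [::]; split=> //=; rewrite /fits /=; lia.
(* The length of the store stays within [X]: it grows only by a push, after which the head is at the
   top and the length is the height. *)
have [|p [pth lst fit]] := IH.
  have := walk_head W; move: dos sz; rewrite /height.
  by case: c s {dq hs} => [g||||] [[|x b] [|y t]] //= [<-] /=; lia.
exists ((q1, below s1, above s1) :: p); split=> //=.
  rewrite pth andbT; apply/asboolP; exists c, o.
  by rewrite /store_of /=; case: (s) (s1) dq dos => [? ?] [? ?].
by rewrite /fits /= (leq_trans _ sz) ?leq_addr // (leq_trans _ sz) ?leq_addl.
Qed.

Definition conf_count (q X : nat) : nat := q * m.+1 ^ X * m.+1 ^ X.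

(** Removing loops leaves a path without repeated configurations. The inequality is strict because
    the start is counted among them. *)
Lemma short_confs X :
  accepts_within X ->
  exists p : seq conf, [/\ path (fun c c' => `[< conf_step c c' >]) (q0, [::], [::]) p,
    accept (last (q0, [::], [::]) p).1.1, size p < conf_count #|Q| X
    & all (fits X) p].
Proof.
move=> [w [tr [q [s [acc W]]]]].
have [//|p [pth lst /= fit]] := walk_confs W.
rewrite /= in pth lst; move: lst acc; case/shortenP: pth => p' pth' uniq_p' sub lst acc.
have fit' : all (fits X) p' by apply/allP => c /sub; apply/allP.
exists p'; split=> //; first by rewrite lst.
pose T := (Q * X.-tuple (option 'I_m) * X.-tuple (option 'I_m))%type.
pose decode (t : T) : conf := (t.1.1, pmap id t.1.2, pmap id t.2).
have <- : size (map decode (enum {: T})) = conf_count #|Q| X.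
  by rewrite size_map -cardE !card_prod !card_tuple !card_option card_ord.
rewrite -[_ < _]/(size ((q0, [::], [::]) :: p') <= _).
apply: uniq_leq_size => // c c_in.
have /andP[/pad_tuple[tb Eb] /pad_tuple[ta Ea]] : fits X c.
  by move: c_in; rewrite inE => /predU1P[->|/(allP fit')].
apply/mapP; exists (c.1.1, tb, ta); first by rewrite mem_enum.
by rewrite /decode /= Eb Ea; case: (c) => -[].
Qed.

Lemma walk_of_confs (c : conf) (p : seq conf) :
  path (fun c c' => `[< conf_step c c' >]) c p ->
  exists X w tr,
    walk delta 0 X c.1.1 (store_of c) w tr (last c p).1.1 (store_of (last c p)).
Proof.
elim: p c => [|c1 p IH] c /=.
  by exists (height (store_of c)), [::], [::]; constructor; rewrite leqnn.
move=> /andP[/asboolP[a [o [dq dos]]] /IH[X [w [tr W]]]].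
exists (maxn X (height (store_of c))), (seq_of_opt o ++ w), (a :: tr).
apply: walk_cons dq dos _; first by rewrite leq_maxr.
exact: walk_widen (leqnn 0) (leq_maxl _ _) W.
Qed.

End ShortRuns.

(** * Swept words *)

Section Sweeps.

Variables (A : Type) (Q : finType) (m : nat).
Variable delta : Q -> option 'I_m -> bool -> action m -> option A -> Q -> Prop.
Variables (q0 : Q) (accept : Q -> Prop) (l : nat).

Local Notation empty := (Store [::] [::] : store m).
Local Notation walk := (walk delta).
Local Notation lseg := (lseg delta).
Local Notation rseg := (rseg delta).
Local Notation lhalf := (lhalf delta).
Local Notation rhalf := (rhalf delta).

Hypothesis few_reversals : forall X w tr q s,
  accept q -> walk 0 X q0 empty w tr q s -> reversals tr <= l.

Definition swept (y : seq A) : Prop :=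
  exists d X w1 tr1 q1 s1 tr q2 s2 w2 tr2 q s,
  [/\ accept q, monotone d tr, walk 0 X q0 empty w1 tr1 q1 s1,
      walk 0 X q1 s1 y tr q2 s2 & walk 0 X q2 s2 w2 tr2 q s].

Lemma swept_infix y :
  swept y -> exists x z X tr q s,
    accept q /\ walk 0 X q0 empty (x ++ y ++ z) tr q s.
Proof.
move=> [d [X [w1 [tr1 [q1 [s1 [tr [q2 [s2 [w2 [tr2 [q [s [acc _ W1 W W2]]]]]]]]]]]]]].
exists w1, w2, X, (tr1 ++ tr ++ tr2), q, s; split=> //.
exact: walk_cat W1 (walk_cat W W2).
Qed.

(** By superadditivity every copy of [y] during which the head turns uses up a reversal, and there
    are more copies than reversals. *)
Lemma power_sweep X K y q s tr q' s' :
  walk 0 X q s (flatten (nseq K y)) tr q' s' -> reversals tr < K ->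
  exists w1 tr1 q1 s1 d tr2 q2 s2 w3 tr3,
  [/\ monotone d tr2, walk 0 X q s w1 tr1 q1 s1,
      walk 0 X q1 s1 y tr2 q2 s2 & walk 0 X q2 s2 w3 tr3 q' s'].
Proof.
elim: K q s tr => [|K IH] q s tr //= W lt_rev.
have [tr1 [tr2 [q1 [s1 [Etr W1 W2]]]]] := walk_cat_word W; subst tr.
have [/reversals_eq0[d mon]|tr1_gt0] := posnP (reversals tr1).
  exists [::], [::], q, s, d, tr1, q1, s1, (flatten (nseq K y)), tr2; split=> //.
  by constructor; apply: walk_head W1.
have [|w3 [tr3 [q3 [s3 [d [tr4 [q4 [s4 [w5 [tr5 [mon V1 V2 V3]]]]]]]]]]] := IH _ _ _ W2.
  by have := reversals_cat tr1 tr2; lia.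
exists (y ++ w3), (tr1 ++ tr3), q3, s3, d, tr4, q4, s4, w5, tr5; split=> //.
exact: walk_cat V1.
Qed.

Lemma swept_power y x z X tr q s :
  accept q -> walk 0 X q0 empty (x ++ flatten (nseq l.+1 y) ++ z) tr q s ->
  swept y.
Proof.
move=> acc W; have le_l := few_reversals acc W.
have [tr1 [tr2 [q1 [s1 [Etr W1 W1']]]]] := walk_cat_word W.
have [tr3 [tr4 [q2 [s2 [Etr2 W2 W3]]]]] := walk_cat_word W1'.
have lt_l : reversals tr3 < l.+1.
  move: le_l; rewrite Etr Etr2.
  have := reversals_cat tr1 (tr3 ++ tr4); have := reversals_cat tr3 tr4; lia.
have [w4 [tr5 [q3 [s3 [d [tr6 [q4 [s4 [w5 [tr7 [mon V1 V2 V3]]]]]]]]]]] :=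
  power_sweep W2 lt_l.
exists d, X, (x ++ w4), (tr1 ++ tr5), q3, s3, tr6, q4, s4, (w5 ++ z), (tr7 ++ tr4), q, s.
by split=> //; [apply: walk_cat V1|apply: walk_cat W3].
Qed.

(** All the information exchanged across the cut: the direction of the sweep, the episodes before
    and after it, the emptiness of the upper part and the symbol at the cut in mid-sweep, and the
    states at the start, middle and end of the sweep and at acceptance. *)
Definition crossing : finType :=
  (bool * (2 * l.+1).-tuple (option (episode Q m)) *
   (2 * l.+1).-tuple (option (episode Q m)) * (bool * option 'I_m) *
   (Q * Q * Q * Q))%type.

(* A sweep reading [u ++ v] is cut at the height of the head between [u] and
   [v]; an upward sweep reads [u] below the cut and [v] above it, a downward
   one the other way round. *)
Definition past (u : seq A) (c : crossing) : Prop :=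
  let '(d, t1, t2, (f, g), (p1, p2, p3, p4)) := c in
  if d then
    exists h z1 b z2 tr, [/\ lhalf h (pmap id t1) ([::], [::]) z1,
      lseg h u tr f p1 z1 p2 (b, [::]), monotone true tr,
      ohead b = g /\ size b = h & lhalf h (pmap id t2) (b, [::]) z2]
  else
    exists D y1 a y2 tr, [/\ rhalf D (pmap id t1) ([::], [::]) y1,
      rseg D u tr g p1 y1 p2 ([::], a), monotone false tr,
      nilp a = f & rhalf D (pmap id t2) ([::], a) y2].

Definition future (c : crossing) (v : seq A) : Prop :=
  let '(d, t1, t2, (f, g), (p1, p2, p3, p4)) := c in
  [/\ linked q0 (pmap id t1) p1, linked p3 (pmap id t2) p4, accept p4 &
  if d then
    exists D a y3 y4 tr, [/\ rhalf D (pmap id t1) ([::], [::]) ([::], a),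
      nilp a = f, rseg D v tr g p2 ([::], a) p3 y3, monotone true tr
      & rhalf D (pmap id t2) y3 y4]
  else
    exists h b z3 z4 tr, [/\ lhalf h (pmap id t1) ([::], [::]) (b, [::]),
      ohead b = g /\ size b = h, lseg h v tr f p2 (b, [::]) p3 z3,
      monotone false tr & lhalf h (pmap id t2) z3 z4]].

(** The word [u] contributes one half of the whole run and [v] the other; while one of them is read,
    the part of the store belonging to the other stays fixed. *)
Lemma past_future_swept u v c : past u c -> future c v -> swept (u ++ v).
Proof.
case: c => [[[[d t1] t2] [f g]] [[[p1 p2] p3] p4]] /= P [lk1 lk2 acc Fu].
case: d P Fu.
  move=> [h [z1 [b [z2 [tr [L1 Lu mon [bg bh] L2]]]]]].
  move=> [D [a [y3 [y4 [tr' [R1 af Rv mon' R2]]]]]].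
  have [//|w1 [tr1 W1]] := glue lk1 L1 R1.
  have W2 := walk_widen (leqnn 0) (leq_addr D h) (Lu _ af).
  have W3 := Rv _ bg; rewrite bh addnC in W3.
  have /andP[_ h3] := walk_last W3.
  have [w4 [tr4 W4]] := glue lk2 L2 R2 h3.
  exists true, (h + D), w1, tr1, p1, (join z1 ([::], a)), (tr ++ tr'), p3.
  exists (join (b, [::]) y3), w4, tr4, p4, (join z2 y4); split=> //.
    by rewrite /monotone all_cat; apply/andP.
  exact: walk_cat W2 W3.
move=> [D [y1 [a [y2 [tr [R1 Ru mon af R2]]]]]].
move=> [h [b [z3 [z4 [tr' [L1 [bg bh] Lv mon' L2]]]]]].
have [//|w1 [tr1 W1]] := glue lk1 L1 R1.
have W2 := Ru _ bg; rewrite bh addnC in W2.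
have W3 := walk_widen (leqnn 0) (leq_addr D h) (Lv _ af).
have /andP[_ h3] := walk_last W3.
have [w4 [tr4 W4]] := glue lk2 L2 R2 h3.
exists false, (h + D), w1, tr1, p1, (join (b, [::]) y1), (tr ++ tr'), p3.
exists (join z3 ([::], a)), w4, tr4, p4, (join z4 y2); split=> //.
  by rewrite /monotone all_cat; apply/andP.
exact: walk_cat W2 W3.
Qed.

Lemma swept_past_future u v : swept (u ++ v) -> exists c, past u c /\ future c v.
Proof.
move=> [d [X [w1 [tr1 [q1 [s1 [tr [q2 [s2 [w2 [tr2 [q [s [acc mon W1 W W2]]]]]]]]]]]]]].
have le_l := few_reversals acc (walk_cat W1 (walk_cat W W2)).
have := reversals_cat tr tr2; have := reversals_cat tr1 (tr ++ tr2) => rev1 rev2.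
have [trs1 [sz1 flat1 uni1]] := reversals_pieces tr1.
have [trs2 [sz2 flat2 uni2]] := reversals_pieces tr2.
have [tra [trb [qm [sm [Etr Wu Wv]]]]] := walk_cat_word W.
(* Since the sweep is monotone, this cut has the head on one side during [u] and on the other during
   [v]. *)
set h := height sm.
have cut0 : cut_at h (([::], [::]) : seq 'I_m * seq 'I_m) ([::], [::]) by [].
rewrite -flat1 in W1; rewrite -flat2 in W2.
have [sg1 [z1 [y1 [le_sg1 Es1 cut1 lk1 [L1 R1]]]]] := walk_halves uni1 cut0 W1.
have [|t1 Et1] := @pad_tuple _ (2 * l.+1) sg1.
  by apply: leq_trans le_sg1 _; rewrite sz1; lia.
subst s1.
have /andP[_ le_m] := walk_last Wu; have /andP[_ le_2] := walk_last Wv.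
have /andP[_ le_1] := walk_head Wu.
move: mon; rewrite Etr /monotone all_cat => /andP[].
case: d => mona monb.
  have [le_1m {}Wu] := walk_monotone_up mona Wu.
  have [y1_nil [z' [Em cut' Lu]]] := walk_below cut1 Wu.
  have [_ {}Wv] := walk_monotone_up monb Wv.
  have hE : h = height (join z' y1) by rewrite -Em.
  rewrite Em in Wv.
  have [z'_nil z'_size [y' [Es2 cut2 Rv]]] := walk_above cut' (walk_widen (eq_leq hE) le_2 Wv).
  rewrite Es2 in W2.
  have [sg2 [z2 [y2 [le_sg2 _ _ lk2 [L2 R2]]]]] := walk_halves uni2 cut2 W2.
  have [|t2 Et2] := @pad_tuple _ (2 * l.+1) sg2.
    by apply: leq_trans le_sg2 _; rewrite sz2; lia.
  case: z' z'_nil z'_size Lu Rv L2 {hE Em cut' cut2 Es2 Wv W2} => b tz /= -> bh Lu Rv L2.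
  case: y1 y1_nil Lu Rv R1 {Wu cut1 W1 W le_1 le_1m} => ty a /= -> Lu Rv R1.
  exists (true, t1, t2, (nilp a, ohead b), (q1, qm, q2, q)); rewrite /= Et1 Et2.
  split; first by exists h, z1, b, z2, tra.
  split=> //; exists (X - h), a, y', y2, trb; split=> //.
have [le_1m {}Wu] := walk_monotone_down mona Wu.
have [z1_nil z1_size [y' [Em cut' Ru]]] := walk_above cut1 (walk_widen (leqnn _) le_1 Wu).
have [_ {}Wv] := walk_monotone_down monb Wv.
(* The head is at height [h] and the lower part already has [h] cells, so no cell of the upper part
   lies at or under the head. *)
have y'_nil : y'.1 = [::].
  apply: size0nil; move: z1_size; rewrite /h Em /height /= size_cat; lia.
have hE : h = height (join z1 y') by rewrite -Em.
rewrite Em in Wv.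
have [_ [z' [Es2 cut2 Lv]]] := walk_below cut' (walk_widen (leqnn _) (eq_leq (esym hE)) Wv).
rewrite Es2 in W2.
have [sg2 [z2 [y2 [le_sg2 _ _ lk2 [L2 R2]]]]] := walk_halves uni2 cut2 W2.
have [|t2 Et2] := @pad_tuple _ (2 * l.+1) sg2.
  by apply: leq_trans le_sg2 _; rewrite sz2; lia.
case: z1 z1_nil z1_size L1 Ru Lv {cut1 W1 W Wu Em hE cut' le_1 le_1m Wv} => b tz /= -> bh L1 Ru Lv.
case: y' y'_nil Ru Lv R2 {Es2 cut2 W2} => ty a /= -> Ru Lv R2.
exists (false, t1, t2, (nilp a, ohead b), (q1, qm, q2, q)); rewrite /= Et1 Et2.
split; first by exists (X - h), y1, a, y2, tra.
by split=> //; exists h, b, z', z2, trb.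
Qed.

(** The set of crossings compatible with a prefix determines which continuations give a swept word.
    If two prefixes of [y] share this set, the factor between them can be cut out. *)
Lemma short_unswept y :
  ~ swept y -> exists2 y', ~ swept y' & size y' <= 2 ^ #|crossing|.
Proof.
move: {2}(size y) (erefl (size y)) => n; elim/ltn_ind: n y => n IH y sz_y unswept.
have [le_n|lt_n] := leqP n (2 ^ #|crossing|); first by exists y; rewrite ?sz_y.
pose R i (x : {ffun crossing -> bool}) := forall c, x c <-> past (take i y) c.
have [i [j [x [lt_ij lt_jn Ri Rj]]]] : exists i j x, [/\ i < j, j < n, R i x & R j x].
  apply: pigeonhole => [|i _]; first by rewrite card_ffun card_bool.
  by exists [ffun c => `[< past (take i y) c >]] => c; rewrite ffunE; split=> /asboolP.
apply: (IH (size (take i y ++ drop j y)) _ (take i y ++ drop j y)) => //.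
  by rewrite size_cat size_take size_drop sz_y; case: ifP; lia.
move=> /swept_past_future[c [/Ri/Rj past_c future_c]]; apply: unswept.
by rewrite -(cat_take_drop j y); apply: past_future_swept past_c future_c.
Qed.

End Sweeps.

Definition crossing_count (q m l : nat) : nat :=
  2 * summary_count q m l * summary_count q m l * (2 * m.+1) * (q * q * q * q).

Lemma card_crossing (Q : finType) (m l : nat) :
  #|crossing Q m l| = crossing_count #|Q| m l.
Proof.
by rewrite /crossing /crossing_count -card_episodes !card_prod card_bool card_option card_ord.
Qed.

(** * Infixes of accepted words *)

Lemma drop_eq_cons (T : Type) (j : nat) (s : seq T) x u :
  drop j s = x :: u -> drop j.+1 s = u.
Proof. by rewrite -addn1 addnC -drop_drop => -> /=; rewrite drop0. Qed.

Section Matching.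

Variables (k n m : nat) (M : stack_automaton k n m).

Definition transition (q : 'I_n) (g : option 'I_m) (f : bool) (c : action m)
    (o : option 'I_k) (q' : 'I_n) : Prop :=
  List.In (Rule q o g f q' c) (rules M).

Lemma run_walk q s w tr q' s' :
  run M q s w tr q' s' -> exists X, walk transition 0 X q s w tr q' s'.
Proof.
elim=> {q s w tr q' s'} [q s|[p o g f p' c] q s q1 s1 w tr q' s' r_in].
  by exists (height s); constructor; rewrite leqnn.
move=> [/= <- <- Eg Ef dos] _ [X W].
exists (maxn X (height s)); apply: walk_cons dos _; first by rewrite leq_maxr.
  by rewrite -Eg -Ef; exact: r_in.
exact: walk_widen (leqnn 0) (leq_maxl _ _) W.
Qed.

Lemma walk_run X q s w tr q' s' :
  walk transition 0 X q s w tr q' s' -> run M q s w tr q' s'.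
Proof.
elim=> {q s w tr q' s'} [q s _|q s c o q1 s1 w tr q' s' _ dq dos _ R].
  by constructor.
by apply: (run_cons (r := Rule q o (ohead (below s)) (nilp (above s)) q1 c) dq _ R).
Qed.

Variable y : seq 'I_k.

(* [j] letters of [y] have been matched; letters of the input outside [y] may
   be skipped before the match begins or after it is complete. *)
Definition advance (j : nat) (o : option 'I_k) (j' : nat) : Prop :=
  if o is Some a then
    (j' = j /\ (j = 0 \/ j = size y)) \/
    (ohead (drop j y) = Some a /\ j' = j.+1)
  else j' = j.

Definition match_state : finType := ('I_n * 'I_(size y).+1)%type.

(** The letter of [M] is guessed and nothing is read: that [y] is an infix becomes mere existence of
    an accepting walk, to which the height and length bounds apply. *)
Definition match_transition (p : match_state) (g : option 'I_m) (f : bool)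
    (c : action m) (o : option unit) (p' : match_state) : Prop :=
  o = None /\ exists2 a, transition p.1 g f c a p'.1 & advance p.2 a p'.2.

Definition match_init : match_state := (initial M, ord0).

Definition match_accept (p : match_state) : Prop :=
  p.1 \in finals M /\ p.2 = size y :> nat.

(** The condition on [x] expresses that skipping is over once the match has begun; [drop p.2 y] is
    what remains to be matched. *)
Lemma match_walk X p s w tr p' s' :
  walk match_transition 0 X p s w tr p' s' -> p'.2 = size y :> nat ->
  exists x z, [/\ 0 < p.2 -> x = [::]
    & walk transition 0 X p.1 s (x ++ drop p.2 y ++ z) tr p'.1 s'].
Proof.
elim=> {p s w tr p' s'} [p s hs Ep|p s c o p1 s1 w tr p' s' hs].
  by exists [::], [::]; split=> //; rewrite Ep drop_size; exact: walk_nil.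
move=> [_ [a dq adv]] dos _ IH /IH[x [z [Ex W]]].
have {}W := walk_cons hs dq dos W; case: a {dq} adv W => [a|] /= adv W; last first.
  by exists x, z; rewrite -adv.
case: adv W => [[-> [j0|jy]] W|[hd Ej] W].
- by exists (a :: x), z; split=> [|//]; rewrite ?j0.
- exists [::], (a :: x ++ z); split=> //.
  by move: W; rewrite jy drop_size.
- exists [::], z; split=> //.
  move: W; rewrite Ex ?Ej //=; case E: (drop p.2 y) hd => [//|b u] /= [->].
  by rewrite (drop_eq_cons E).
Qed.

Lemma walk_match X q s x (j : 'I_(size y).+1) z tr q' s' :
  walk transition 0 X q s (x ++ drop j y ++ z) tr q' s' -> (0 < j -> x = [::]) ->
  exists p', [/\ walk match_transition 0 X (q, j) s [::] tr p' s', p'.1 = q'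
    & p'.2 = size y :> nat].
Proof.
move E: (_ ++ _) => w W; elim: W x j z E => {q s w tr q' s'} [q s hs|].
  move=> [|//] j z /eqP E _; exists (q, j); split=> //; first by constructor.
  move: E; rewrite -size_eq0 /= !size_cat size_drop /=.
  by have := ltn_ord j; lia.
move=> q s c o q1 s1 w tr q' s' hs dq dos _ IH x j z E Ex.
suff [x1 [j1 [z1 [E1 Ex1 adv]]]] : exists x1 (j1 : 'I_(size y).+1) z1,
    [/\ x1 ++ drop j1 y ++ z1 = w, 0 < j1 -> x1 = [::] & advance j o j1].
  have [p' [W' ? ?]] := IH _ _ _ E1 Ex1; exists p'; split=> //.
  rewrite -[[::]]/(seq_of_opt (None : option unit) ++ [::]).
  by apply: walk_cons dos W' => //; split=> //; exists o.
case: o {dq} E => [a|] /= E; last by exists x, j, z.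
case: x E Ex => [|b x] E Ex; last first.
  have j0 : j = 0 :> nat by case: posnP Ex => // _ /(_ isT).
  case: E => _ E.
  by exists x, j, z; split=> //; [rewrite j0|left; split=> //; left].
have [ge_j|lt_j] := leqP (size y) j.
  have jy : j = size y :> nat by have := ltn_ord j; lia.
  exists [::], j, w; split=> //; first by rewrite jy drop_size.
  by left; split=> //; right.
move: E; case Ed: (drop j y) => [|b u] /=.
  by move/eqP: Ed; rewrite -size_eq0 size_drop subn_eq0 leqNgt lt_j.
move=> [-> Ew]; exists [::], (Ordinal (n := (size y).+1) (m := j.+1) lt_j), z.
split=> //=; last by right.
by rewrite (drop_eq_cons Ed).
Qed.

Lemma match_reversals l X w tr p s :
  reversal_bound M l -> match_accept p ->
  walk match_transition 0 X match_init (Store [::] [::]) w tr p s ->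
  reversals tr <= l.
Proof.
move=> bound [fin Ep] /match_walk/(_ Ep)[x [z [_ /walk_run R]]].
by apply: bound; exists p.1, s; split; [exact: fin|exact: R].
Qed.

Lemma infixes_match :
  infixes (accepted M) y <->
  exists X, accepts_within match_transition match_init match_accept X.
Proof.
split=> [[x [z [tr [q [s [fin /run_walk[X W]]]]]]]|].
  rewrite -[y in x ++ y ++ z]drop0 in W.
  have [//|p [W' Eq Ep]] := @walk_match _ _ _ _ ord0 _ _ _ _ W.
  by exists X, [::], tr, p, s; split=> //; split; rewrite ?Eq.
move=> [X [w [tr [p [s [[fin Ep] /match_walk/(_ Ep)[x [z [_ /walk_run R]]]]]]]]].
rewrite /= drop0 in R; exists x, z, tr, p.1, s; by split.
Qed.

End Matching.

Lemma unswept_short_word k n m (M : stack_automaton k n m) l :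
  reversal_bound M l -> ~ dense (accepted M) ->
  exists2 y, size y <= l.+1 * 2 ^ crossing_count n m l & ~ infixes (accepted M) y.
Proof.
move=> bound /existsNP[y0 y0_out].
pose swept := swept (transition M) (initial M) (fun q => q \in finals M).
have few X w tr q s : q \in finals M ->
    walk (transition M) 0 X (initial M) (Store [::] [::]) w tr q s -> reversals tr <= l.
  by move=> fin /walk_run R; apply: bound; exists q, s; split; [exact: fin|exact: R].
have [|y unswept sz_y] := short_unswept few (y := y0).
  by move=> /swept_infix[x [z [X [tr [q [s [fin /walk_run R]]]]]]]; apply: y0_out;
     exists x, z, tr, q, s.
(* This power is the source of the factor [l.+1] in the bound. *)
exists (flatten (nseq l.+1 y)).
  rewrite size_flatten /shape map_nseq sumn_nseq mulnC leq_mul2l.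
  by apply: leq_trans sz_y _; rewrite card_crossing card_ord.
move=> [x [z [tr [q [s [fin /run_walk[X W]]]]]]]; apply: unswept.
exact: (swept_power few fin W).
Qed.

(** * Arithmetization of runs *)

Local Arguments CodeSeq.code : simpl never.

Definition seq_code (k : nat) (s : seq 'I_k) : nat := CodeSeq.code (map val s).

Lemma seq_code_cons k (g : 'I_k) s : seq_code (g :: s) = consc g (seq_code s).
Proof. by rewrite -code_cons. Qed.

Lemma seq_code_eq0 k (s : seq 'I_k) : (seq_code s == 0) = nilp s.
Proof. by rewrite code_eq0; case: s. Qed.

Lemma consc_neq0 x c : (consc x c == 0) = false.
Proof. by have [] := consc_gt x c; case: consc. Qed.

(* The numerical predicates below follow the layout of [rule_code] and
   [action_code]; [b] and [a] are codes of the two lists of a store. *)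
Definition scanb (o b : nat) : bool := o == (b != 0) * (headc b).+1.

Definition actb (t b a b' a' : nat) : bool :=
  [|| [&& t == 0, b' == b & a' == a],
      [&& t == 1, b == consc (headc b) b' & a' == consc (headc b) a],
      [&& t == 2, a == consc (headc a) a' & b' == consc (headc a) b],
      [&& t == 3, a == 0, a' == 0 & b == consc (headc b) b']
    | [&& 3 < t, a == 0, a' == 0 & b' == consc (t - 4) b]].

Definition advanceb (y o j j' : nat) : bool :=
  if o == 0 then j' == j
  else (j' == j) && ((j == 0) || (j == sizec y)) ||
    [&& dropc y j != 0, o == (headc (dropc y j)).+1 & j' == j.+1].

Definition ruleb (r y x x' : nat) : bool :=
  [&& nthc r 0 == nthc x 0, scanb (nthc r 2) (nthc x 1),
      nthc r 3 == (nthc x 2 == 0), nthc r 4 == nthc x' 0,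
      actb (nthc r 5) (nthc x 1) (nthc x 2) (nthc x' 1) (nthc x' 2)
    & advanceb y (nthc r 1) (nthc x 3) (nthc x' 3)].

(** Entries 0 and 1 of the automaton code hold the parameters and the final states; the rules start
    at entry 2. *)
Definition stepb (N y x x' : nat) : bool :=
  exb (sizec N) (fun i => (1 < i) && ruleb (nthc N i) y x x').

(** The certificate [t] lists configurations, each given by its state, the codes of the two store
    lists, and the number of matched letters. *)
Definition checkb (N y t len : nat) : bool :=
  [&& nthc (nthc t 0) 0 == nthc (nthc N 0) 3, nthc (nthc t 0) 1 == 0,
      nthc (nthc t 0) 2 == 0, nthc (nthc t 0) 3 == 0,
      allb len (fun i => stepb N y (nthc t i) (nthc t i.+1)),
      exb (sizec (nthc N 1)) (fun i => nthc (nthc N 1) i == nthc (nthc t len) 0)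
    & nthc (nthc t len) 3 == sizec y].

Lemma scanbP k (o : option 'I_k) (b : seq 'I_k) :
  reflect (o = ohead b) (scanb (option_code o) (seq_code b)).
Proof.
have -> : scanb (option_code o) (seq_code b) = (option_code o == option_code (ohead b)).
  by case: b => [|g b] //; rewrite /scanb seq_code_cons headc_cons consc_neq0 mul1n.
apply: (iffP eqP) => [|->//]; exact: option_code_inj.
Qed.

(** Here [b'] and [a'] are arbitrary numbers: that they code stacks follows from the test, so
    certificates need no separate validation. *)
Lemma actb_sound m (c : action m) b a b' a' :
  actb (action_code c) (seq_code b) (seq_code a) b' a' ->
  exists s, [/\ do_action c (Store b a) = Some s, b' = seq_code (below s)
    & a' = seq_code (above s)].
Proof.
case: c => [g||||]; rewrite /actb /= ?orbF.
- rewrite !subSS subn0 seq_code_eq0.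
  case: a => //= /andP[/eqP-> /eqP->].
  by exists (Store (g :: b) [::]); rewrite seq_code_cons.
- rewrite seq_code_eq0; case: a => //= /andP[/eqP->].
  case: b => [|g b]; first by rewrite eq_sym consc_neq0.
  rewrite seq_code_cons headc_cons => /eqP/consc_inj[_ <-].
  by exists (Store b [::]).
- case: b => [|g b]; first by rewrite eq_sym consc_neq0.
  rewrite seq_code_cons headc_cons => /andP[/eqP/consc_inj[_ <-] /eqP->].
  by exists (Store b (g :: a)); rewrite seq_code_cons.
- case: a => [|g a]; first by rewrite eq_sym consc_neq0.
  rewrite (seq_code_cons g a) headc_cons => /andP[/eqP/consc_inj[_ <-] /eqP->].
  by exists (Store (g :: b) a); rewrite seq_code_cons; case: b.
- by move=> /andP[/eqP-> /eqP->]; exists (Store b a).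
Qed.

Lemma actb_complete m (c : action m) b a s :
  do_action c (Store b a) = Some s ->
  actb (action_code c) (seq_code b) (seq_code a) (seq_code (below s)) (seq_code (above s)).
Proof.
case: c => [g||||]; rewrite /actb /= ?orbF.
- by case: a => //= -[<-]; rewrite !subSS subn0 seq_code_cons !eqxx.
- by case: a b => [|? ?] [|g b] //= [<-] /=; rewrite seq_code_cons headc_cons !eqxx.
- by case: b => [|g b] //= [<-] /=; rewrite !seq_code_cons headc_cons !eqxx.
- case: a b => [|g a] [|? b] //= [<-] /=;
    by rewrite (seq_code_cons g a) headc_cons seq_code_cons !eqxx.
- by move=> [<-]; rewrite !eqxx.
Qed.

Lemma advancebP k (y : seq 'I_k) (o : option 'I_k) j j' :
  reflect (advance y j o j') (advanceb (seq_code y) (option_code o) j j').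
Proof.
rewrite /advanceb /seq_code sizec_code size_map dropc_code -map_drop -/(seq_code (drop j y)).
case: o => [a|] /=; last exact: eqP.
have -> : [&& seq_code (drop j y) != 0, a.+1 == (headc (seq_code (drop j y))).+1 & j' == j.+1]
  = (ohead (drop j y) == Some a) && (j' == j.+1).
  case: (drop j y) => [|b u] //; rewrite seq_code_cons headc_cons consc_neq0 /= eqSS.
  by rewrite eq_sym.
apply: (iffP orP) => -[].
- by case/andP=> /eqP-> /orP[]/eqP; left; split=> //; [left|right].
- by case/andP=> /eqP Ea /eqP Ej; right.
- by case=> -> [] ->; left; rewrite !eqxx ?orbT.
- by case=> -> ->; right; rewrite !eqxx.
Qed.

Section Checker.

Variables (k n m : nat) (M : stack_automaton k n m) (y : seq 'I_k).

Local Notation N := (automaton_number M).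
Local Notation conf := (match_state n y * seq 'I_m * seq 'I_m)%type.
Local Notation cstep := (conf_step (match_transition M (y := y))).

(** Weaker than equality with [conf_code c], because the entries of a certificate are arbitrary
    numbers, possibly codes of longer lists. *)
Definition represents (x : nat) (c : conf) : Prop :=
  [/\ nthc x 0 = c.1.1.1, nthc x 1 = seq_code c.1.2, nthc x 2 = seq_code c.2
    & nthc x 3 = c.1.1.2].

Definition conf_code (c : conf) : nat :=
  CodeSeq.code [:: c.1.1.1 : nat; seq_code c.1.2; seq_code c.2; c.1.1.2 : nat].

Lemma conf_codeP c : represents (conf_code c) c.
Proof. by split; rewrite nthc_code. Qed.

Lemma nthc_params i : nthc (nthc N 0) i = nth 0 [:: k; n; m; initial M : nat] i.
Proof. by rewrite nthc_code /= nthc_code. Qed.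

Lemma finalsP (q : nat) :
  reflect (exists2 p : 'I_n, p \in finals M & q = p :> nat)
    (exb (sizec (nthc N 1)) (fun i => nthc (nthc N 1) i == q)).
Proof.
rewrite nthc_code [nth _ _ _]/= sizec_code size_map.
apply: (iffP (exbP _ _)) => [[i lt_i /eqP <-]|[p p_in ->]].
  rewrite nthc_code; exists (nth (initial M) (finals M) i); first exact: mem_nth.
  by rewrite (nth_map (initial M)).
exists (index p (finals M)); first by rewrite index_mem.
by rewrite nthc_code (nth_map p) ?index_mem // nth_index.
Qed.

Lemma rulesP (P : nat -> bool) :
  exb (sizec N) (fun i => (1 < i) && P (nthc N i)) <->
  exists r, List.In r (rules M) /\ P (CodeSeq.code (rule_code r)).
Proof.
have nth_rule i : nthc N i.+2 = nth 0 [seq CodeSeq.code (rule_code r) | r <- rules M] i.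
  by rewrite nthc_code /= -map_comp.
have sz : sizec N = (size (rules M)).+2 by rewrite sizec_code !size_map /= size_map.
rewrite sz; split=> [/exbP[[|[|i]] //= lt_i]|[r [r_in Pr]]].
  rewrite nth_rule; move: lt_i; rewrite !ltnS.
  elim: (rules M) i => [|r rs IH] [|i] //= lt_i Pi; first by exists r; split=> //; left.
  by have [r' [r'_in Pr']] := IH i lt_i Pi; exists r'; split=> //; right.
have [i [lt_i Pi]] : exists i, i < size (rules M) /\ P (nthc N i.+2).
  have : exists i, i < size (rules M) /\
      P (nth 0 [seq CodeSeq.code (rule_code r) | r <- rules M] i).
    elim: (rules M) r_in => //= r' rs IH [->|/IH[i [lt_i Pi]]]; first by exists 0.
    by exists i.+1.
  by move=> [i [lt_i Pi]]; exists i; rewrite nth_rule.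
by apply/exbP; exists i.+2.
Qed.

Lemma stepb_sound x x' c :
  represents x c -> stepb N (seq_code y) x x' ->
  exists c', represents x' c' /\ cstep c c'.
Proof.
case: c => [[[q j] b] a] [/= xq xb xa xj].
move=> /(rulesP (fun r => ruleb r (seq_code y) x x'))[[p o g f p' t] [r_in]].
rewrite /ruleb !nthc_code /= xq xb xa xj.
move=> /and5P[/eqP/val_inj Ep /scanbP Eg /eqP Ef /eqP xq' /andP[]].
move=> /actb_sound[s [dos xb' xa']] /advancebP adv.
(* The match position either stays or advances past a letter of [y] still present. *)
have lt_j : nthc x' 3 < (size y).+1.
  case: o adv {r_in} => [e|] /=; last by move=> ->.
  case=> [[-> _]|[hd ->]] //; rewrite ltnS ltnNge; apply: contraPN hd.
  by move=> /drop_oversize->.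
exists (p', Ordinal lt_j, below s, above s); split; first by split.
exists t, None; split=> /=; last by rewrite /store_of /= dos; case: (s).
split=> //; exists o => //=; rewrite /transition.
by move: Ef; rewrite seq_code_eq0 -Eg => /esym; case: (f) (nilp a) r_in => [] [] //; rewrite Ep.
Qed.

Lemma stepb_complete x x' c c' :
  represents x c -> represents x' c' -> cstep c c' -> stepb N (seq_code y) x x'.
Proof.
case: c c' => [[[q j] b] a] [[[q' j'] b'] a'] [/= xq xb xa xj] [/= xq' xb' xa' xj'].
move=> [t [o [[_ [e r_in adv]] dos]]].
apply/(rulesP (fun r => ruleb r (seq_code y) x x'));
exists (Rule q e (ohead b) (nilp a) q' t); split; first exact: r_in.
rewrite /ruleb !nthc_code /= xq xb xa xj xq' xb' xa' xj' !eqxx seq_code_eq0 eqxx /=.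
apply/and3P; split; first exact/scanbP.
  exact: (actb_complete dos).
exact/advancebP.
Qed.

Local Notation start := ((match_init M y, [::], [::]) : conf).

Lemma checkb_sound t len : checkb N (seq_code y) t len -> infixes (accepted M) y.
Proof.
rewrite /checkb nthc_params /=.
case/and5P=> /eqP t0 /eqP t1 /eqP t2 /eqP t3 /and3P[/allbP steps /finalsP fin /eqP lenE].
have start_rep : represents (nthc t 0) start by split.
suff [p [c [pth Ec rep]]] : exists p c, [/\ path (fun c c' => `[< cstep c c' >]) start p,
    last start p = c & represents (nthc t len) c].
  have [X [w [tr W]]] := walk_of_confs pth; rewrite Ec in W.
  apply/infixes_match; exists X, w, tr, c.1.1, (store_of c); split=> //.
  case: rep fin lenE => -> _ _ -> [q q_in /val_inj Eq] Ej.
  by split; [rewrite Eq|rewrite Ej sizec_code size_map].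
elim: len steps {fin lenE} => [|len IH] steps; first by exists [::], start.
have [|p [c [pth Ec rep]]] := IH; first by move=> i lt_i; apply/steps/ltnW.
have [c' [rep' st]] := stepb_sound rep (steps len (ltnSn _)).
exists (rcons p c'), c'; rewrite rcons_path last_rcons pth Ec; split=> //.
exact/asboolP.
Qed.

Lemma checkb_complete (p : seq conf) :
  path (fun c c' => `[< cstep c c' >]) start p ->
  match_accept M (last start p).1.1 ->
  checkb N (seq_code y) (CodeSeq.code (map conf_code (start :: p))) (size p).
Proof.
set t := CodeSeq.code _ => pth [fin Ep].
have tE i : i <= size p -> represents (nthc t i) (nth start (start :: p) i).
  move=> le_i; rewrite nthc_code (nth_map start) //; exact: conf_codeP.
have [t0 t1 t2 t3] := tE 0 isT.
have [tq _ _ tj] := tE _ (leqnn _).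
rewrite (nth_last start (start :: p)) /= in tq tj.
rewrite /checkb nthc_params t0 t1 t2 t3 !eqxx /=; apply/and3P; split.
- apply/allbP => i lt_i; apply: stepb_complete (tE _ (ltnW lt_i)) (tE _ lt_i) _.
  by apply/asboolP; have /(pathP start)/(_ _ lt_i) := pth.
- by apply/finalsP; exists (last start p).1.1.1.
- by rewrite tj Ep sizec_code size_map.
Qed.

End Checker.

(** * The decision procedure *)

(** The bounds follow the argument: codes of candidate words, then, for the matching automaton with
    [n * sz.+1] states, the height and length of a short run, the code of one of its configurations
    (four entries), and the code of the run. *)
Definition word_bound (k n m l : nat) : nat :=
  2 ^ (k.+1 * (l.+1 * 2 ^ crossing_count n m l)).

Definition height_bound (n m l sz : nat) : nat := summary_count (n * sz.+1) m l.

Definition length_bound (n m l sz : nat) : nat :=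
  conf_count m (n * sz.+1) (height_bound n m l sz).

Definition entry_bound (n m l sz : nat) : nat :=
  2 ^ ((n + 2 ^ (m.+1 * height_bound n m l sz) + sz.+1).+1 * 4).

Definition run_bound (n m l sz : nat) : nat :=
  2 ^ ((entry_bound n m l sz).+1 * length_bound n m l sz).

(** Numbers that do not code a word over [k] letters pass by the first disjunct. *)
Definition decide (N l : nat) : bool :=
  let k := nthc (nthc N 0) 0 in
  let n := nthc (nthc N 0) 1 in
  let m := nthc (nthc N 0) 2 in
  allb (word_bound k n m l) (fun y =>
    ~~ allb (sizec y) (fun i => nthc y i < k) ||
    exb (run_bound n m l (sizec y)) (fun t =>
      exb (length_bound n m l (sizec y)) (fun len => checkb N y t len))).

Lemma seq_code_bound k V (s : seq 'I_k) L :
  k <= V -> size s <= L -> seq_code s < 2 ^ (V.+1 * L).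
Proof.
move=> le_kV le_sL; apply: code_bound; first by rewrite size_map.
by rewrite all_map; apply/allP => i _ /=; apply: leq_trans (ltn_ord i) le_kV.
Qed.

Lemma ltn_seqP k (s : seq nat) : all (gtn k) s -> exists y : seq 'I_k, s = map val y.
Proof.
elim: s => [_|x s IH /= /andP[lt_x /IH[y ->]]]; first by exists [::].
by exists (Ordinal lt_x :: y).
Qed.

Lemma infixes_check k n m (M : stack_automaton k n m) l (y : seq 'I_k) :
  reversal_bound M l -> infixes (accepted M) y ->
  exists2 t, t < run_bound n m l (size y) &
  exists2 len, len < length_bound n m l (size y) &
    checkb (automaton_number M) (seq_code y) t len.
Proof.
move=> bound /infixes_match[X0 acc0].
have := accepts_within_low (fun X w tr p s => match_reversals bound) acc0.
rewrite card_prod !card_ord => /short_confs[p [pth acc]].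
rewrite card_prod !card_ord -/(height_bound _ _ _ _) => lt_p fit.
exists (CodeSeq.code (map (@conf_code k n m y) ((match_init M y, [::], [::]) :: p))).
  apply: code_bound; first by rewrite /= size_map.
  apply/allP => _ /mapP[[[[q j] b] a] c_in ->].
  have /andP[/= le_b le_a] : fits (height_bound n m l (size y)) ((q, j), b, a).
    by move: c_in; rewrite inE => /predU1P[->|/(allP fit)].
  apply: code_bound => //=.
  have := seq_code_bound (leqnn m) le_b; have := seq_code_bound (leqnn m) le_a.
  by have := ltn_ord q; have := ltn_ord j; move=> /=; lia.
by exists (size p) => //; apply: checkb_complete.
Qed.

Lemma decideP k n m (M : stack_automaton k n m) l :
  reversal_bound M l -> decide (automaton_number M) l <-> dense (accepted M).
Proof.
move=> bound; rewrite /decide !nthc_params [nth _ _ 0]/= [nth _ _ 1]/= [nth _ _ 2]/=.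
split=> [/allbP dec|den].
  apply: contrapT => /(unswept_short_word bound)[y sz_y]; apply.
  have /orP[/negP[]|/exbP[t _ /exbP[len _ /checkb_sound]]//] :=
    dec _ (seq_code_bound (leqnn k) sz_y).
  apply/allbP => i; rewrite /seq_code sizec_code size_map nthc_code => lt_i.
  (* A default letter for [nth_map]: the alphabet may be empty, but an index [i] into [y] provides a
     letter. *)
  have [a _] : exists a : 'I_k, true by case: y lt_i {sz_y} => // a; exists a.
  by rewrite (nth_map a) //; apply: ltn_ord.
apply/allbP => c _; rewrite -[c]CodeSeq.decodeK.
move: (CodeSeq.decode c) => s; rewrite sizec_code.
have [/allbP lt_s|//] := boolP (allb _ _).
have /ltn_seqP[y Es] : all (gtn k) s.
  by apply/(all_nthP 0) => i /lt_s; rewrite nthc_code.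
have [t lt_t [len lt_len ok]] := infixes_check bound (den y).
rewrite Es size_map; apply/exbP; exists t => //.
by apply/exbP; exists len.
Qed.

(** * Computability of the decision procedure *)

Lemma computable_bool_if a (c f g : seq nat -> bool) :
  computable a c -> computable a f -> computable a g ->
  computable a (fun e => if c e then f e else g e).
Proof.
move=> Cc Cf Cg.
apply: (@computable_ext _ (fun e => (c e && f e) || (~~ c e && g e))).
  by move=> e; case: (c e); case: (f e); case: (g e).
by computability.
Qed.

Lemma computable_stepb a f g h k :
  computable a f -> computable a g -> computable a h -> computable a k ->
  computable a (fun e => stepb (f e) (g e) (h e) (k e)).
Proof.
apply: (@computable_comp4 a (fun N y x x' => stepb N y x x')).
apply: computable_exb; last by computability.
cbv beta; rewrite /ruleb /scanb /actb /advanceb.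
repeat first [apply: computable_bool_if | progress computability].
Qed.

Lemma computable_checkb a f g h k :
  computable a f -> computable a g -> computable a h -> computable a k ->
  computable a (fun e => checkb (f e) (g e) (h e) (k e)).
Proof.
apply: (@computable_comp4 a (fun N y t len => checkb N y t len)).
rewrite /checkb; computability.
- by apply: computable_allb; [apply: computable_stepb|]; computability.
- by apply: computable_exb; computability.
Qed.

Lemma computable_decide : computable 2 (fun e => decide (nth 0 e 0) (nth 0 e 1)).
Proof.
rewrite /decide /=.
apply: computable_allb; last first.
  by rewrite /word_bound /crossing_count /summary_count; computability.
computability.
  by apply: computable_allb; computability.
apply: computable_exb; last first.
  rewrite /run_bound /entry_bound /length_bound /conf_count /height_bound /summary_count.
  by computability.
apply: computable_exb; last first.
  by rewrite /length_bound /conf_count /height_bound /summary_count; computability.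
by apply: computable_checkb; computability.
Qed.

Theorem corollary5 :
  exists decider : recfun,
    forall (k n m : nat) (M : stack_automaton k n m) (l : nat),
      reversal_bound M l ->
      exists b : bool,
        rec_eval decider [:: automaton_number M; l] b /\
        (b <-> dense (accepted M)).
Proof.
have [c cP] := computable_decide; exists c => k n m M l bound.
exists (decide (automaton_number M) l); split; last exact: decideP.
exact: (cP [:: automaton_number M; l]).
Qed.
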